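(* Let $n,d\ge1$ be integers and let $p$ be a prime with $p>d$. Let $x^{\mathbf a_1},\dots,x^{\mathbf a_l}$ be the distinct monomials of degree $d$ in the variables $x_1,\dots,x_n$. For a field $\Bbbk$ of characteristic $p$ with $[\Bbbk:\Bbbk^p]<\infty$ and $\alpha=(\alpha_1,\dots,\alpha_l)\in\Bbbk^l$, consider the polynomial $f=\alpha_1x^{\mathbf a_1}+\cdots+\alpha_lx^{\mathbf a_l}\in\mathfrak m^d$, where $\mathfrak m=\langle x_1,\dots,x_n\rangle\subset\Bbbk[x_1,\dots,x_n]$. (1) If $\Bbbk=\mathbb F_p(\alpha_1,\dots,\alpha_l)$ and $\alpha_1,\dots,\alpha_l$ are algebraically independent over $\mathbb F_p$, then $\tau(f^t)=(\mathfrak m^d)^{[t]}$ for every real $0<t<1$. (2) There exists a finite nonempty set of nonzero polynomials $\Sigma\subseteq\mathbb F_p[z_1,\dots,z_l]$, which may depend on $n$ and $d$ (and $p$) but is independent of the field $\Bbbk$, with the following property: for every such $\Bbbk$ and every $\alpha\in\Bbbk^l$ not in the closed set $\mathbb V(\Sigma)\subseteq\Bbbk^l$ (the common zero locus of $\Sigma$ in $\Bbbk^l$), every critical exponent of $\mathfrak m^d$ is an $F$-jumping exponent of $f$.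
   Context: Let $R=\Bbbk[x_1,\dots,x_n]$ and let $\mathfrak a$ be a nonzero proper ideal of $R$. Frobenius powers. For an ideal $\mathfrak b$ of $R$ and $e\ge0$, $\mathfrak b^{[p^e]}=\langle h^{p^e}:h\in\mathfrak b\rangle$, and $\mathfrak b^{[1/p^e]}$ is the smallest ideal $\mathfrak c$ with $\mathfrak b\subseteq\mathfrak c^{[p^e]}$. If $m\in\mathbb N$ has base $p$ expansion $m=m_0+m_1p+\cdots+m_rp^r$, then $\mathfrak a^{[m]}=\mathfrak a^{m_0}(\mathfrak a^{m_1})^{[p]}\cdots(\mathfrak a^{m_r})^{[p^r]}$. For $t=m/p^e$ with $m\in\mathbb N$, $\mathfrak a^{[t]}=(\mathfrak a^{[m]})^{[1/p^e]}$. For real $t\ge0$, $\mathfrak a^{[t]}=\bigcup_k\mathfrak a^{[t_k]}$, where $(t_k)$ is any sequence of rational numbers whose denominators are powers of $p$ converging to $t$ monotonically from above (the union equals $\mathfrak a^{[t_k]}$ for $k\gg0$). A real $\lambda>0$ is a critical exponent of $\mathfrak a$ if $\mathfrak a^{[\lambda-\varepsilon]}$ properly contains $\mathfrak a^{[\lambda]}$ for every $0<\varepsilon\le\lambda$. Test ideals. For real $t\ge0$, $\tau(\mathfrak a^t)=(\mathfrak a^{\lceil tp^e\rceil})^{[1/p^e]}$ for all $e\gg0$; $\tau(f^t)$ means $\tau(\langle f\rangle^t)$. A real $\lambda>0$ is an $F$-jumping exponent of $\mathfrak a$ if $\tau(\mathfrak a^{\lambda-\varepsilon})$ properly contains $\tau(\mathfrak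 a^\lambda)$ for every $0<\varepsilon\le\lambda$; the $F$-jumping exponents of $f$ are those of $\langle f\rangle$. *)

(* Defs.v *)
From mathcomp Require Import all_boot all_order all_algebra.
From mathcomp Require Import boolp classical_sets reals.
From mathcomp Require Import mpoly.
Set Implicit Arguments.
Unset Strict Implicit.
Unset Printing Implicit Defensive.
Import Order.TTheory GRing.Theory Num.Theory.
Local Open Scope classical_set_scope.
Local Open Scope ring_scope.

(* Ideals are arbitrary sets of ring elements: MathComp's [idealr_closed]
   only describes proper ideals, and the unit ideal is needed here. *)
Definition is_ideal (A : comNzRingType) (I : set A) : Prop :=
  [/\ I 0, (forall x y, I x -> I y -> I (x + y))
    & forall r x, I x -> I (r * x)].

Definition gen_ideal (A : comNzRingType) (S : set A) : set A :=
  smallest (@is_ideal A) S.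

Definition mul_ideal (A : comNzRingType) (I J : set A) : set A :=
  gen_ideal [set z | exists x y, [/\ I x, J y & z = x * y]].

Definition exp_ideal (A : comNzRingType) (I : set A) (m : nat) : set A :=
  iter m (mul_ideal I) setT.

Section FrobeniusPowers.
Variables (A : comNzRingType) (p : nat).
Implicit Types (I J : set A) (m e : nat).

(* I^[p^e] *)
Definition frob_ideal e I : set A := gen_ideal [set x ^+ (p ^ e)%N | x in I].

Definition is_frob_root e I J : Prop :=
  [/\ is_ideal J, I `<=` frob_ideal e J
    & forall J', is_ideal J' -> I `<=` frob_ideal e J' -> J `<=` J'].

(* I^[1/p^e], totalized as an intersection: whenever a smallest ideal J with
   I contained in J^[p^e] exists, this is it (see [frob_rootE]). *)
Definition frob_root e I : set A :=
  \bigcap_(J in [set J | is_ideal J /\ I `<=` frob_ideal e J]) J.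

Lemma frob_rootE e I J : is_frob_root e I J -> frob_root e I = J.
Proof.
case=> Jid IJ Jmin; apply/seteqP; split=> [x|x Jx J' [J'id IJ']].
  by apply; split.
exact: Jmin Jx.
Qed.

Definition digit m i : nat := ((m %/ p ^ i) %% p)%N.

(* I^[m]; for m > 0, [trunc_log p m] is the index of the leading digit of m,
   and I^[0] is the unit ideal. *)
Definition frob_pow_nat I m : set A :=
  foldr (@mul_ideal A) setT
    [seq frob_ideal i (exp_ideal I (digit m i))
       | i <- iota 0 (trunc_log p m).+1].

(* I^[m/p^e] *)
Definition frob_pow_rat I m e : set A := frob_root e (frob_pow_nat I m).

Section Real.
Variable R : realType.
Implicit Types t lambda eps : R.

(* |~t p^e~|, for t >= 0 *)
Definition ceil_scaled t e : nat := `|Num.ceil (t * (p ^ e)%:R)|%N.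

(* I^[t] for t >= 0, computed along t_k = |~t p^k~| / p^k, which converges to
   t monotonically from above. *)
Definition frob_pow I t : set A :=
  \bigcup_(k in [set: nat]) frob_pow_rat I (ceil_scaled t k) k.

Definition critical_exponent I lambda : Prop :=
  0 < lambda /\
  forall eps, 0 < eps <= lambda ->
    frob_pow I lambda `<` frob_pow I (lambda - eps).

(* tau(I^t) for t >= 0: the eventual value of (I^|~t p^e~|)^[1/p^e]. *)
Definition test_ideal I t : set A :=
  [set x | exists e0, forall e, (e0 <= e)%N ->
     frob_root e (exp_ideal I (ceil_scaled t e)) x].

Definition F_jumping_exponent I lambda : Prop :=
  0 < lambda /\
  forall eps, 0 < eps <= lambda ->
    test_ideal I lambda `<` test_ideal I (lambda - eps).

End Real.
End FrobeniusPowers.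

(* [k : k^p] < oo, i.e. k is spanned over k^p by finitely many elements. *)
Definition F_finite (p : nat) (k : fieldType) : Prop :=
  exists b : seq k, forall x, exists c : 'I_(size b) -> k,
    x = \sum_(i < size b) c i ^+ p * b`_i.

(* The value of g at alpha, coefficients being sent along 'F_p -> k for a
   field k of characteristic p. *)
Definition evalFp (p l : nat) (k : fieldType) (alpha : 'I_l -> k)
    (g : {mpoly 'F_p[l]}) : k :=
  mmap (fun c : 'F_p => (c : nat)%:R) alpha g.

Definition alg_indep (p l : nat) (k : fieldType) (alpha : 'I_l -> k) : Prop :=
  forall g : {mpoly 'F_p[l]}, evalFp alpha g = 0 -> g = 0.

Definition is_subfield (k : fieldType) (S : set k) : Prop :=
  [/\ S 1, (forall x y, S x -> S y -> S (x - y)),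
      (forall x y, S x -> S y -> S (x * y)) & forall x, S x -> S x^-1].

(* k = F_p(alpha): every subfield contains the prime field, so it need not be
   listed among the generators. *)
Definition field_generated (l : nat) (k : fieldType) (alpha : 'I_l -> k) :
    Prop :=
  smallest (@is_subfield k) (range alpha) = setT.

Definition zero_locus (p l : nat) (k : fieldType)
    (Sigma : seq {mpoly 'F_p[l]}) : set ('I_l -> k) :=
  [set alpha | forall s, s \in Sigma -> evalFp alpha s = 0].

(* a lists the exponents of the distinct monomials of degree d *)
Definition lists_monomials (n d l : nat) (a : l.-tuple 'X_{1..n}) : Prop :=
  uniq a /\ forall u : 'X_{1..n}, (u \in a) = (mdeg u == d).

Definition monomial_comb (n l : nat) (k : fieldType) (a : l.-tuple 'X_{1..n})
    (alpha : 'I_l -> k) : {mpoly k[n]} :=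
  \sum_(i < l) alpha i *: 'X_[tnth a i].

Definition maxid (n : nat) (k : fieldType) : set {mpoly k[n]} :=
  gen_ideal (range (fun i : 'I_n => 'X_i : {mpoly k[n]})).

(* Main.v *)
(* Write J_m for the monomial ideal (m^d)^[m], so that (m^d)^[m/p^e] is
   generated by the x^floor(w/p^e) with x^w in J_m.  Expanding the generic form
   (sum_j z_j x^(a_j))^m over F_p[z], the monomials x^w that occur generate J_m.

   (1) If the alpha_j are algebraically independent and generate k, the
   monomials in alpha with exponents < p^e form a basis of k over k^(p^e).  For
   m < p^e the terms of f^m then lie on distinct basis elements, whence
   (f^m)^[1/p^e] = (m^d)^[m/p^e]; take m = ceil(t p^e) and let e grow.

   (2) One always has tau(f^t) inside (m^d)^[t].  Criticality of lambda is a
   property of exponents only; shifting by integers, and treating lambda = 1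
   directly, leaves the critical lambda in (0,1), a finite set C since the
   (m^d)^[t] with t < 1 are monomial ideals generated in degrees <= d.  The set
   C + {1} is stable under the base p shift lambda -> lambda p - c in (0,1].
   For lambda in it let m_e be the largest integer < lambda p^e: the ideals
   (f^(m_e))^[1/p^e] decrease with e, are generated in degrees <= d, and the
   step e+1 at lambda is determined by the step e at the shift of lambda.
   Hence all these chains are stationary from an index E that depends only on
   n, d and p.  As lambda is critical, some coefficient of f^(m_E), a nonzero
   polynomial over F_p in alpha, must vanish for (f^(m_E))^[1/p^E] to lie in
   (m^d)^[lambda]; the product of these polynomials over C, times one of the
   variables to ensure that f is nonzero, is the required Sigma. *)
Require Import Defs.
From HB Require Import structures.
From mathcomp Require Import all_boot all_order all_algebra.
From mathcomp Require Import boolp classical_sets reals.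
From mathcomp Require Import mpoly.
From mathcomp Require Import zify.
Set Implicit Arguments.
Unset Strict Implicit.
Unset Printing Implicit Defensive.
Import Order.TTheory GRing.Theory Num.Theory.
Local Open Scope classical_set_scope.
Local Open Scope ring_scope.

(** * Ideals and Frobenius roots *)

Section Ideals.
Variable A : comNzRingType.
Implicit Types (I J S : set A) (x y : A).

Lemma gen_ideal_ideal S : is_ideal (gen_ideal S).
Proof.
split=> [J [[]]//|x y Sx Sy J [Jid SJ]|r x Sx J [Jid SJ]].
  by case: (Jid) => _ JD _; apply: JD; [apply: Sx|apply: Sy].
by case: (Jid) => _ _; apply; apply: Sx.
Qed.

Lemma gen_ideal_sub S J : is_ideal J -> (gen_ideal S `<=` J) <-> (S `<=` J).
Proof.
move=> Jid; split=> [gSJ|]; last exact: smallest_sub.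
exact: subset_trans (@sub_smallest _ _ _ _ (@subset_refl _ S)) gSJ.
Qed.

Lemma sub_gen_ideal S : S `<=` gen_ideal S.
Proof. by apply/(gen_ideal_sub S (gen_ideal_ideal S)). Qed.

Lemma gen_ideal1 x : gen_ideal [set x] = [set r * x | r in setT].
Proof.
apply/seteqP; split=> [|_ [r _ <-]].
  apply/gen_ideal_sub=> [|_ ->]; last by exists 1; rewrite ?mul1r.
  split=> [|_ _ [r _ <-] [s _ <-]|r _ [s _ <-]].
  - by exists 0; rewrite ?mul0r.
  - by exists (r + s); rewrite ?mulrDl.
  - by exists (r * s); rewrite ?mulrA.
by case: (gen_ideal_ideal [set x]) => _ _; apply; apply: sub_gen_ideal.
Qed.

Lemma ideal_sum I (T : Type) (r : seq T) (P : pred T) (F : T -> A) :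
  is_ideal I -> (forall i, P i -> I (F i)) -> I (\sum_(i <- r | P i) F i).
Proof. by move=> [I0 ID _] IF; apply: big_ind. Qed.

Lemma exp_ideal_gen1 x m : exp_ideal (gen_ideal [set x]) m = gen_ideal [set x ^+ m].
Proof.
elim: m => [|m IHm] /=.
  apply/seteqP; split=> // y _; rewrite gen_ideal1; exists y => //.
  by rewrite mulr1.
rewrite -/(exp_ideal _ m) IHm.
apply/seteqP; split; apply/gen_ideal_sub; try exact: gen_ideal_ideal.
  move=> _ [y [z [+ + ->]]]; rewrite !gen_ideal1 => -[r _ <-] [s _ <-].
  by exists (r * s); rewrite // exprS mulrACA.
move=> _ ->; apply: sub_gen_ideal; exists x, (x ^+ m).
by split; [apply: sub_gen_ideal|apply: sub_gen_ideal|rewrite exprS].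
Qed.

Lemma scale_ideal_ideal x I : is_ideal I -> is_ideal [set x * y | y in I].
Proof.
case=> I0 ID IM; split=> [|_ _ [y Iy <-] [z Iz <-]|r _ [y Iy <-]].
- by exists 0; rewrite ?mulr0.
- by exists (y + z); rewrite ?mulrDr //; apply: ID.
- by exists (r * y); rewrite 1?mulrCA //; apply: IM.
Qed.

End Ideals.

(* The coordinates of a p^e-basis: the maps [c i] are the p^(-e)-linear
   (Cartier) operators that compute the ideals I^[1/p^e]. *)
Definition frob_dual (A : comNzRingType) (q : nat) (T : finType)
    (c : T -> A -> A) (b : T -> A) : Prop :=
  [/\ forall i, {morph c i : x y / x + y},
      forall i r x, c i (r ^+ q * x) = r * c i x
    & forall x, x = \sum_i c i x ^+ q * b i].

Section FrobeniusIdeals.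
Variables (A : comNzRingType) (p : nat).
Hypothesis pcharA : p \in [pchar A].
Implicit Types (I J S : set A) (x y : A) (e : nat).

Let p_prime : prime p. Proof. exact: pcharf_prime pcharA. Qed.

Lemma exp_pe_gt0 e : (0 < p ^ e)%N.
Proof. by rewrite expn_gt0 prime_gt0. Qed.

Lemma frobD e x y : (x + y) ^+ (p ^ e) = x ^+ (p ^ e) + y ^+ (p ^ e).
Proof. by apply: exprDn_pchar; rewrite pnatX pnatE // pcharA. Qed.

Lemma frob_sum e (T : Type) (r : seq T) (P : pred T) (F : T -> A) :
  (\sum_(i <- r | P i) F i) ^+ (p ^ e) = \sum_(i <- r | P i) F i ^+ (p ^ e).
Proof.
apply: (big_morph (fun x => x ^+ (p ^ e)) (frobD e)).
by rewrite expr0n gtn_eqF ?exp_pe_gt0.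
Qed.

Lemma frob_ideal_ideal e I : is_ideal (frob_ideal p e I).
Proof. exact: gen_ideal_ideal. Qed.

Lemma frob_ideal_exp e I x : I x -> frob_ideal p e I (x ^+ (p ^ e)).
Proof. by move=> Ix; apply: sub_gen_ideal; exists x. Qed.

Lemma frob_ideal_sub e I J : is_ideal J ->
  (frob_ideal p e I `<=` J) <-> (forall x, I x -> J (x ^+ (p ^ e))).
Proof.
move=> Jid; rewrite /frob_ideal gen_ideal_sub //; split=> [IJ x Ix|IJ _ [x Ix <-]].
  by apply: IJ; exists x.
exact: IJ.
Qed.

Lemma frob_ideal_mono e I J : I `<=` J -> frob_ideal p e I `<=` frob_ideal p e J.
Proof.
move=> IJ; apply/frob_ideal_sub=> [|x Ix]; first exact: frob_ideal_ideal.
by apply: frob_ideal_exp; apply: IJ.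
Qed.

Lemma frob_ideal_subset e I : is_ideal I -> frob_ideal p e I `<=` I.
Proof.
move=> Iid; apply/frob_ideal_sub=> // x Ix; case: Iid => _ _ IM.
by rewrite -(prednK (exp_pe_gt0 e)) exprSr; apply: IM.
Qed.

Lemma frob_preideal e J : is_ideal J -> is_ideal [set y | J (y ^+ (p ^ e))].
Proof.
case=> J0 JD JM; split=> [|x y Jx Jy|r x Jx] /=.
- by rewrite expr0n gtn_eqF ?exp_pe_gt0.
- by rewrite frobD; apply: JD.
- by rewrite exprMn; apply: JM.
Qed.

Lemma frob_ideal_comp e1 e2 I :
  frob_ideal p e1 (frob_ideal p e2 I) = frob_ideal p (e1 + e2) I.
Proof.
apply/seteqP; split; (apply/frob_ideal_sub; first exact: frob_ideal_ideal).
  apply/frob_ideal_sub=> [|x Ix]; first exact: frob_preideal (frob_ideal_ideal _ _).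
  by rewrite /= -exprM -expnD addnC; apply: frob_ideal_exp.
move=> x Ix; rewrite expnD mulnC exprM; do 2!apply: frob_ideal_exp; exact: Ix.
Qed.

Lemma frob_root_ideal e I : is_ideal (frob_root p e I).
Proof.
split=> [J [[]]//|x y Ix Iy J [Jid IJ]|r x Ix J [Jid IJ]].
  by case: (Jid) => _ JD _; apply: JD; [apply: Ix|apply: Iy].
by case: (Jid) => _ _; apply; apply: Ix.
Qed.

Lemma frob_root_min e I J :
  is_ideal J -> I `<=` frob_ideal p e J -> frob_root p e I `<=` J.
Proof. by move=> Jid IJ x; apply. Qed.

Lemma frob_root_mono e I J : I `<=` J -> frob_root p e I `<=` frob_root p e J.
Proof.
by move=> IJ x Ix K [Kid JK]; apply: Ix; split=> //; apply: subset_trans JK.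
Qed.

Lemma frob_root_gen e S : frob_root p e (gen_ideal S) = frob_root p e S.
Proof.
apply/seteqP; split; last by apply: frob_root_mono; apply: sub_gen_ideal.
move=> x gSx J [Jid SJ]; apply: gSx; split=> //.
by apply/gen_ideal_sub => //; apply: frob_ideal_ideal.
Qed.

Section Dual.
Variables (e : nat) (T : finType) (c : T -> A -> A) (b : T -> A).
Hypothesis cb : frob_dual (p ^ e) c b.

(** The [y] with [c i (r * y)] in [J] for every [r] form an ideal, which by p^(-e)-linearity
    contains the p^e-th powers of the elements of [J]. *)
Lemma frob_dual_ideal i J x : is_ideal J -> frob_ideal p e J x -> J (c i x).
Proof.
move=> Jid; have [cD cM _] := cb; have [J0 JD JM] := Jid.
suff /(_ x) sub : frob_ideal p e J `<=` [set y | forall r, J (c i (r * y))].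
  by move=> /sub/(_ 1); rewrite mul1r.
apply/frob_ideal_sub => [|y Jy r /=].
  split=> [r|y z Jy Jz r|s y Jy r] /=.
  - have /(congr1 (fun z => z - c i 0)) := cD i 0 0.
    by rewrite addr0 addrK subrr mulr0 => <-.
  - by rewrite mulrDr cD; apply: JD.
  - by rewrite mulrA.
by rewrite mulrC cM mulrC; apply: JM.
Qed.

Lemma frob_dual_root i I x : I x -> frob_root p e I (c i x).
Proof. by move=> Ix J [Jid IJ]; apply: frob_dual_ideal => //; apply: IJ. Qed.

Lemma frob_dual_decomp I x : (forall i, I (c i x)) -> frob_ideal p e I x.
Proof.
have [_ _ cE] := cb; move=> Ic; rewrite [x]cE.
apply: ideal_sum => [|i _]; first exact: frob_ideal_ideal.
case: (frob_ideal_ideal e I) => _ _ IM; rewrite mulrC; apply: IM.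
exact: frob_ideal_exp.
Qed.

(** Coordinates make the intersection in [frob_root] a minimum: it is itself one of the ideals that
    are intersected. *)
Lemma sub_frob_root I : I `<=` frob_ideal p e (frob_root p e I).
Proof. by move=> x Ix; apply: frob_dual_decomp => i; apply: frob_dual_root. Qed.

Lemma frob_root_sub I J : is_ideal J ->
  (frob_root p e I `<=` J) <-> (I `<=` frob_ideal p e J).
Proof.
move=> Jid; split=> [IJ|]; last exact: frob_root_min.
by apply: subset_trans (@sub_frob_root I) _; apply: frob_ideal_mono.
Qed.

Lemma frob_rootE_dual I :
  frob_root p e I = gen_ideal [set y | exists2 x, I x & exists i, y = c i x].
Proof.
apply/seteqP; split.
  apply: frob_root_min; first exact: gen_ideal_ideal.
  move=> x Ix; apply: frob_dual_decomp => i; apply: sub_gen_ideal.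
  by exists x => //; exists i.
apply/gen_ideal_sub=> [|_ [x Ix [i ->]]]; first exact: frob_root_ideal.
exact: frob_dual_root.
Qed.

(** By p^(-e)-linearity a factor [x ^+ (p ^ e)] leaves the root as [x]; integral shifts of an
    exponent thus become multiplication by a power of f. *)
Lemma frob_root_scale x I :
  frob_root p e [set x ^+ (p ^ e) * y | y in I] = [set x * y | y in frob_root p e I].
Proof.
have [_ cM _] := cb; have Rid := frob_root_ideal e I.
apply/seteqP; split.
  apply: frob_root_min; first exact: scale_ideal_ideal.
  move=> _ [y /sub_frob_root Iy <-]; apply: frob_dual_decomp => i.
  by rewrite cM; exists (c i y) => //; apply: frob_dual_ideal.
move=> _ [y Iy <-]; set K := frob_root p e _.
have [K0 KD KM] : is_ideal K by apply: frob_root_ideal.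
(* The colon ideal of [K] by [x] is compared with the root through minimality. *)
suff : frob_root p e I `<=` [set z | K (x * z)] by apply.
apply: frob_root_min.
  split=> [|u v Ku Kv|r u Ku] /=; rewrite ?mulr0 // ?mulrDr 1?mulrCA //.
    exact: KD.
  exact: KM.
move=> z Iz; apply: frob_dual_decomp => i /=; rewrite -cM.
by apply: frob_dual_root; exists z.
Qed.

Lemma frob_root_setT : frob_root p e [set (1 : A)] = setT.
Proof.
apply/seteqP; split=> // x _ J [Jid /(_ 1 erefl) J1].
case: (Jid) => _ _ JM; rewrite -(mulr1 x); apply: JM.
exact: frob_ideal_subset J1.
Qed.

Lemma frob_root_exp x : frob_root p e [set x ^+ (p ^ e)] = gen_ideal [set x].
Proof.
have := frob_root_scale x [set 1]; rewrite image_set1 mulr1 => ->.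
by rewrite frob_root_setT gen_ideal1; apply/seteqP; split=> _ [y _ <-];
  exists y; rewrite // mulrC.
Qed.

End Dual.

Lemma frob_dual_comp e1 e2 (T1 T2 : finType) c1 b1 c2 b2 :
  @frob_dual A (p ^ e1) T1 c1 b1 -> @frob_dual A (p ^ e2) T2 c2 b2 ->
  frob_dual (p ^ (e1 + e2)) (fun ij x => c2 ij.2 (c1 ij.1 x))
    (fun ij => b2 ij.2 ^+ (p ^ e1) * b1 ij.1).
Proof.
move=> [c1D c1M c1E] [c2D c2M c2E]; split=> [ij x y|ij r x|x] /=.
- by rewrite c1D c2D.
- by rewrite addnC expnD exprM c1M c2M.
rewrite [LHS]c1E (eq_bigr (fun i => \sum_j
    c2 j (c1 i x) ^+ (p ^ (e1 + e2)) * (b2 j ^+ (p ^ e1) * b1 i))) => [|i _].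
  by rewrite pair_bigA.
rewrite {1}(c2E (c1 i x)) frob_sum mulr_suml; apply: eq_bigr => j _.
by rewrite exprMn -exprM -expnD addnC mulrA.
Qed.

Lemma frob_root_comp e1 e2 (T1 T2 : finType) c1 b1 c2 b2 I :
  @frob_dual A (p ^ e1) T1 c1 b1 -> @frob_dual A (p ^ e2) T2 c2 b2 ->
  frob_root p e1 (frob_root p e2 I) = frob_root p (e1 + e2) I.
Proof.
move=> d1 d2; apply/seteqP; split.
  have Rid := frob_root_ideal (e1 + e2) I.
  apply/(frob_root_sub d1) => //; apply/(frob_root_sub d2).
    exact: frob_ideal_ideal.
  rewrite frob_ideal_comp addnC; exact: sub_frob_root (frob_dual_comp d1 d2) _.
apply: frob_root_min; first exact: frob_root_ideal.
rewrite addnC -frob_ideal_comp; apply: subset_trans (sub_frob_root d2 (I := I)) _.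
by apply: frob_ideal_mono; apply: (sub_frob_root d1).
Qed.

End FrobeniusIdeals.

(** * Exponents of the Frobenius powers of m^d *)

Lemma sub_mdeg_exists (n d : nat) (v : 'X_{1..n}) : (d <= mdeg v)%N ->
  exists2 y : 'X_{1..n}, (y <= v)%MM & mdeg y = d.
Proof.
elim: d => [|d IHd] dv.
  by exists 0%MM; [apply/mnm_lepP => i; rewrite mnm0E|rewrite mdeg0].
have [y yv yd] := IHd (ltnW dv).
have [i lti] : exists i, (y i < v i)%N.
  apply/existsP; rewrite -[[exists _, _]]negbK negb_exists.
  apply/negP => /forallP vy; move: dv; rewrite -yd ltnNge => /negP; apply.
  by rewrite !mdegE leq_sum // => i _; rewrite leqNgt vy.
exists (y + U_(i))%MM; last by rewrite mdegD mdeg1 yd addn1.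
apply/mnm_lepP => j; rewrite mnmDE mnm1E.
by case: eqP => [<-|_]; rewrite ?addn1 ?addn0 //; apply/mnm_lepP.
Qed.

Definition mdivn (n : nat) (v : 'X_{1..n}) (q : nat) : 'X_{1..n} :=
  [multinom (v i %/ q)%N | i < n].

(* Membership of the exponent [v] in the monomial ideal (m^d)^[m], along the
   base p expansion of m: the digit c contributes the factor
   (m^d)^c = m^(dc). *)
Inductive fexp (n d p : nat) : nat -> 'X_{1..n} -> Prop :=
| Fexp0 v : fexp d p 0 v
| FexpS c m v0 v1 v : (c < p)%N -> (d * c <= mdeg v0)%N -> fexp d p m v1 ->
    (v0 + v1 *+ p <= v)%MM -> fexp d p (c + p * m) v.

(* Membership of [v] in ((m^d)^[m])^[1/p^e], whose generators are the
   integral parts of w/p^e for [w] in [fexp m]. *)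
Definition rexp (n d p m e : nat) (v : 'X_{1..n}) : Prop :=
  exists2 w, fexp d p m w & forall i, (w i < p ^ e * (v i).+1)%N.

Section Exponents.
Variables (n d p : nat).
Hypothesis p_gt1 : (1 < p)%N.
Implicit Types (v w y : 'X_{1..n}) (m e c : nat).

Let p_gt0 : (0 < p)%N. Proof. exact: ltnW. Qed.
Let pe_gt0 e : (0 < p ^ e)%N. Proof. by rewrite expn_gt0 p_gt0. Qed.

Local Notation fexp := (@fexp n d p).
Local Notation rexp := (@rexp n d p).

Lemma fexpP m v : fexp m v <-> exists v0 v1,
  [/\ (d * (m %% p) <= mdeg v0)%N, fexp (m %/ p) v1 & (v0 + v1 *+ p <= v)%MM].
Proof.
split=> [|[v0] [v1] [dv0 fv1 lev]].
  case=> [{}v|c {}m v0 v1 {}v cp dv0 fv1 lev].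
    exists 0%MM, 0%MM; rewrite mod0n div0n muln0; split=> //; first exact: Fexp0.
    by apply/mnm_lepP => i; rewrite mnmDE mulmnE !mnm0E.
  exists v0, v1; rewrite [(c + _)%N]addnC [(p * m)%N]mulnC.
    rewrite modnMDl modn_small // divnMDl //.
  by rewrite divn_small // addn0.
rewrite (divn_eq m p) addnC mulnC; apply: FexpS dv0 fv1 lev.
by rewrite ltn_mod.
Qed.

Lemma fexp_up m v w : (v <= w)%MM -> fexp m v -> fexp m w.
Proof.
move=> vw /fexpP[v0] [v1] [? ? lev]; apply/fexpP; exists v0, v1; split=> //.
exact: lepm_trans vw.
Qed.

(** If the units digit is positive, [y] is taken from its factor. If it is zero, [y] is borrowed
    from the higher digits: of the p copies of [y] there, one is removed and the other p - 1 provide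
    the new units digit p - 1. *)
Lemma fexp_descend m v : fexp m v -> (0 < m)%N ->
  exists y, [/\ mdeg y = d, (y <= v)%MM & fexp m.-1 (v - y)%MM].
Proof.
elim=> [//|[|c] {}m v0 v1 {}v cp dv0 fv1 IHv /mnm_lepP lev].
  rewrite add0n muln_gt0 p_gt0 => m_gt0.
  have [y [dy /mnm_lepP yv1 fy]] := IHv m_gt0.
  exists y; split=> //.
    by apply/mnm_lepP => i; move: (lev i) (yv1 i); rewrite mnmDE mulmnE; nia.
  have -> : (p * m).-1 = (p.-1 + p * m.-1)%N by nia.
  apply: (FexpS (v0 := (v0 + y *+ p.-1)%MM)) fy _; first by rewrite prednK.
    by rewrite mdegD mdegMn dy leq_addl.
  apply/mnm_lepP => i; move: (lev i) (yv1 i).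
  by rewrite !(mnmDE, mulmnE, mnmBE); nia.
move=> _; have [|y /mnm_lepP yv0 dy] := @sub_mdeg_exists n d v0; first by nia.
exists y; split=> //.
  by apply/mnm_lepP => i; move: (lev i) (yv0 i); rewrite mnmDE; lia.
rewrite addSn /=; apply: (FexpS (v0 := (v0 - y)%MM)) fv1 _; first exact: ltnW.
  have /(congr1 (@mdeg n)) := submK (introT mnm_lepP yv0).
  by rewrite mdegD dy => ?; nia.
by apply/mnm_lepP => i; move: (lev i) (yv0 i); rewrite !(mnmDE, mnmBE); lia.
Qed.

Lemma fexp_mono m m' v : (m' <= m)%N -> fexp m v -> fexp m' v.
Proof.
elim: m => [|m IHm]; first by rewrite leqn0 => /eqP ->.
rewrite leq_eqVlt => /predU1P[->//|m'm] fv; apply: IHm => //.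
have [y [_ _ fy]] := fexp_descend fv (ltn0Sn m).
by apply: fexp_up fy; apply: lem_subr.
Qed.

(** For m < p^e the digits of [s] and of [m] do not overlap, so the ideal factors as
    ((m^d)^[s])^[p^e] times (m^d)^[m]. *)
Lemma fexp_split e s m v : (m < p ^ e)%N ->
  fexp (s * p ^ e + m) v <->
  exists w0 w1, [/\ fexp s w0, fexp m w1 & (w0 *+ (p ^ e) + w1 <= v)%MM].
Proof.
elim: e m v => [|e IHe] m v me.
  move: me; rewrite expn0 ltnS leqn0 => /eqP ->; rewrite addn0 muln1.
  split=> [fv|[w0 [w1 [fw0 _]]]].
    exists v, 0%MM; split=> //; first exact: Fexp0.
    by rewrite mulm1n addm0 lepm_refl.
  by rewrite mulm1n => lev; apply: fexp_up fw0; apply: lepm_trans lev; apply: lem_addr.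
have mpe : (m %/ p < p ^ e)%N by rewrite ltn_divLR // -expnSr.
have modE : ((s * p ^ e.+1 + m) %% p = m %% p)%N by rewrite expnSr mulnA modnMDl.
have divE : ((s * p ^ e.+1 + m) %/ p = s * p ^ e + m %/ p)%N.
  by rewrite expnSr mulnA divnMDl.
split=> [/fexpP[v0 [v1]]|[w0 [w1 [fw0 /fexpP[v0 [v1 [dv0 fv1 /mnm_lepP le1]]]]]]].
  rewrite modE divE => -[dv0 /(IHe _ _ mpe)[w0 [w1 [fw0 fw1 /mnm_lepP le1]]]].
  move=> /mnm_lepP le2; exists w0, (v0 + w1 *+ p)%MM; split=> //.
    by apply/fexpP; exists v0, w1; rewrite lepm_refl.
  apply/mnm_lepP => i; move: (le1 i) (le2 i).
  by rewrite !(mnmDE, mulmnE) expnSr; nia.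
move=> /mnm_lepP le2; apply/fexpP; exists v0, (w0 *+ (p ^ e) + v1)%MM.
rewrite modE divE; split=> //.
  by apply/(IHe _ _ mpe); exists w0, v1; rewrite lepm_refl.
apply/mnm_lepP => i; move: (le1 i) (le2 i).
by rewrite !(mnmDE, mulmnE) expnSr; nia.
Qed.

Lemma rexp_up m e v w : (v <= w)%MM -> rexp m e v -> rexp m e w.
Proof.
move=> /mnm_lepP vw [u fu ltu]; exists u => // i.
by apply: leq_trans (ltu i) _; rewrite leq_mul2l ltnS vw orbT.
Qed.

Lemma rexp_mono m m' e v : (m' <= m)%N -> rexp m e v -> rexp m' e v.
Proof. by move=> mm' [u fu ltu]; exists u => //; apply: fexp_mono fu. Qed.

Lemma rexp_step m m' e v : (m' <= p * m)%N -> rexp m e v -> rexp m' e.+1 v.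
Proof.
move=> m'm [w fw ltw]; apply: (@rexp_mono (p * m)) => //.
exists (w *+ p)%MM => [|i]; last first.
  by rewrite mulmnE expnSr -mulnA [(p * _)%N]mulnC mulnA ltn_pmul2r.
rewrite -[(p * m)%N]add0n; apply: (FexpS (v0 := 0%MM)) fw _ => //.
  by rewrite muln0.
by rewrite add0m lepm_refl.
Qed.

(** The fraction m p^j / p^(e+j) may be reduced; with [rexp_step], the ideal depends only on the
    value of the fraction. *)
Lemma rexp_frob m e j v : rexp (m * p ^ j) (e + j) v -> rexp m e v.
Proof.
rewrite -[(m * _)%N]addn0 => -[w /fexp_split[//|w0 [w1 [fw0 _ /mnm_lepP lew]]] ltw].
exists w0 => // i; rewrite -(ltn_pmul2r (pe_gt0 j)).
move: (leq_ltn_trans (lew i) (ltw i)); rewrite mnmDE mulmnE expnD; nia.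
Qed.

(** Integral parts are taken first for p^e, then for p^j. The factor of the leading digits [s] is a
    p^e-th power and passes the first stage as [w0]; the low digits [m] leave an exponent [y] of
    (m^d)^[m/p^e]. *)
Lemma rexp_split e j s m v : (m < p ^ e)%N ->
  rexp (s * p ^ e + m) (e + j) v <->
  exists w0 y, [/\ fexp s w0, rexp m e y
    & forall i, (w0 i + y i < p ^ j * (v i).+1)%N].
Proof.
move=> me; split=> [[w /(fexp_split _ _ me)[w0 [w1 [fw0 fw1 /mnm_lepP lew]]] ltw]|].
  exists w0, (mdivn w1 (p ^ e)); split=> // [|i].
    by exists w1 => // i; rewrite mnmE mulnC ltn_ceil.
  rewrite -(ltn_pmul2l (pe_gt0 e)) mulnA -expnD; apply: (leq_ltn_trans _ (ltw i)).
  apply: (leq_trans _ (lew i)); rewrite mnmDE mulmnE mnmE.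
  by rewrite mulnDr [(p ^ e * w0 i)%N]mulnC leq_add2l mulnC leq_trunc_div.
move=> [w0 [y [fw0 [w1 fw1 ltw1] lt]]]; exists (w0 *+ (p ^ e) + w1)%MM.
  by apply/(fexp_split _ _ me); exists w0, w1; rewrite lepm_refl.
move=> i; rewrite mnmDE mulmnE expnD -mulnA.
apply: leq_trans (_ : p ^ e * (w0 i + y i).+1 <= _)%N; last first.
  by rewrite leq_pmul2l.
by rewrite -!addnS mulnDr [(p ^ e * w0 i)%N]mulnC leq_add2l.
Qed.

End Exponents.

Lemma mcoeffMXE (n : nat) (R : comNzRingType) (f : {mpoly R[n]}) (m w : 'X_{1..n}) :
  (f * 'X_[m])@_w = if (m <= w)%MM then f@_(w - m) else 0.
Proof.
case: ifPn => [mw|mNw]; first by rewrite -{1}(submK mw) addmC mcoeffMX.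
apply: memN_msupp_eq0; rewrite (perm_mem (msuppMX _ _)).
by apply/mapP => -[v _ wE]; rewrite wE lem_addr in mNw.
Qed.

Lemma leq_mnm_mdeg (n : nat) (v : 'X_{1..n}) i : (v i <= mdeg v)%N.
Proof. by rewrite mdegE (bigD1 i) //= leq_addr. Qed.

Lemma pchar_mpoly (n p : nat) (k : fieldType) :
  p \in [pchar k] -> p \in [pchar {mpoly k[n]}].
Proof. by rewrite pchar_lalg. Qed.

Lemma mpoly_frobE (n p e : nat) (k : fieldType) (f : {mpoly k[n]}) :
  p \in [pchar k] ->
  f ^+ (p ^ e) = \sum_(m <- msupp f) f@_m ^+ (p ^ e) *: 'X_[m *+ (p ^ e)].
Proof.
move=> pchark; rewrite {1}(mpolyE f) (frob_sum (pchar_mpoly n pchark)).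
by apply: eq_bigr => m _; rewrite exprZn mpolyXn.
Qed.

(** * Multinomial coefficients modulo p *)

Section Multinomial.
Variables (l p : nat).
Hypothesis p_prime : prime p.

Let pcharFp : p \in [pchar 'F_p]. Proof. exact: pchar_Fp. Qed.

(** The coefficients of its powers are the multinomial coefficients modulo p. The monomials x^(a_j)
    are left out here and return through [wt]. *)
Definition sumX : {mpoly 'F_p[l]} := \sum_(j < l) 'X_j.

Lemma sumX_homog m u : (sumX ^+ m)@_u != 0 -> mdeg u = m.
Proof.
have : sumX ^+ m \is (1 * m).-homog.
  apply: dhomogMn; apply: rpred_sum => j _.
  by rewrite dhomogX /= mdeg1.
by rewrite mul1n => /dhomog_nemf_coeff h; apply: contraNeq => /h ->.
Qed.

Lemma mderiv_sumX j m : (sumX ^+ m)^`M(j) = sumX ^+ m.-1 *+ m.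
Proof.
have d1 : sumX^`M(j) = 1.
  rewrite /sumX raddf_sum (bigD1 j) //= big1 => [|i ij]; rewrite mderivX mnm1E.
    by rewrite eqxx scale1r addr0 -mpolyX0; congr ('X_[_]); apply/mnmP => i;
      rewrite mnmBE subnn mnm0E.
  by rewrite (negbTE ij) scale0r.
elim: m => [|m IHm]; first by rewrite expr0 mulr0n -mpolyC1 mderivC.
rewrite exprS mderivM d1 IHm mul1r mulrS; case: m {IHm} => [|m].
  by rewrite !mulr0n mulr0.
by rewrite mulrnAr -exprS.
Qed.

(** Differentiating in a variable that occurs in [u] lowers the power by one and multiplies by an
    exponent below p, hence invertible. *)
Lemma sumX_digit_neq0 m u : mdeg u = m -> (m < p)%N -> (sumX ^+ m)@_u != 0.
Proof.
elim: m u => [|m IHm] u.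
  by move/eqP; rewrite mdeg_eq0 => /eqP -> _; rewrite expr0 mcoeff1 eqxx oner_neq0.
move=> um mp; have [j uj] : exists j, u j != 0%N.
  apply/existsP; rewrite -[[exists _, _]]negbK negb_exists; apply/negP => /forallP u0.
  move: um; rewrite mdegE big1 // => j _; apply/eqP.
  by move: (u0 j); rewrite negbK.
have Uu : (U_(j) <= u)%MM by rewrite lep1mP.
have du : mdeg (u - U_(j)) = m.
  by have := congr1 (@mdeg l) (submK Uu); rewrite mdegD mdeg1 um addn1 => -[].
have := mcoeff_deriv j (u - U_(j))%MM (sumX ^+ m.+1).
rewrite mderiv_sumX mcoeffMn submK //= => E.
apply: contraTneq (IHm _ du (ltnW mp)) => Z0.
move: E; rewrite Z0 mul0rn -mulr_natr => /eqP; rewrite mulf_eq0 negbK => /orP[//|].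
by rewrite -(dvdn_pcharf pcharFp) gtnNdvd.
Qed.

(** One step of the congruence of Lucas. As [u0] has degree c < p, its entries are remainders modulo
    p, so [u0 + u1 *+ p] arises in only one way in the product of Z^c and (Z^m)^p. *)
Lemma sumX_frob_mcoeff c m (u0 u1 : 'X_{1..l}) : mdeg u0 = c -> (c < p)%N ->
  (sumX ^+ (c + p * m))@_(u0 + u1 *+ p) = (sumX ^+ c)@_u0 * (sumX ^+ m)@_u1 ^+ p.
Proof.
move=> u0c cp; set w := (u0 + u1 *+ p)%MM.
have := mpoly_frobE 1 (sumX ^+ m) pcharFp; rewrite expn1 => frobE.
rewrite exprD mulnC exprM frobE.
rewrite mulr_sumr raddf_sum /=.
have E b : (sumX ^+ c * ((sumX ^+ m)@_b ^+ p *: 'X_[b *+ p]))@_w =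
    if b == u1 then (sumX ^+ c)@_u0 * (sumX ^+ m)@_u1 ^+ p else 0.
  rewrite -scalerAr mcoeffZ mcoeffMXE.
  have [->|bu1] := eqVneq; first by rewrite lem_addl addmK mulrC.
  case: ifPn => [/mnm_lepP bw|_]; last by rewrite mulr0.
  apply/eqP; rewrite mulf_eq0; apply/orP; right; apply: contraNT bu1 => /sumX_homog dw.
  apply/eqP/mnmP => i; move: (bw i) (leq_mnm_mdeg u0 i).
  move: (leq_mnm_mdeg (w - b *+ p)%MM i); rewrite /w !(mnmDE, mnmBE, mulmnE) -/w dw u0c.
  by nia.
rewrite (eq_bigr _ (fun b _ => E b)) -big_mkcond /=.
have [u1s|u1s] := boolP (u1 \in msupp (sumX ^+ m)).
  by rewrite -big_filter filter_pred1_uniq ?msupp_uniq // big_seq1.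
rewrite (memN_msupp_eq0 u1s) expr0n gtn_eqF ?prime_gt0 // mulr0 big1 //.
Qed.

End Multinomial.

(** * Generators of (m^d)^[m] from nonzero multinomial coefficients *)

Section Generators.
Variables (n d l p : nat) (a : l.-tuple 'X_{1..n}).
Hypotheses (p_prime : prime p) (ha : lists_monomials d a).

Definition wt (u : 'X_{1..l}) : 'X_{1..n} := (\sum_(j < l) tnth a j *+ u j)%MM.

Lemma wtE u i : wt u i = (\sum_(j < l) tnth a j i * u j)%N.
Proof. by rewrite mnm_sumE; apply: eq_bigr => j _; rewrite mulmnE. Qed.

Lemma wtD u v : wt (u + v) = (wt u + wt v)%MM.
Proof.
apply/mnmP => i; rewrite mnmDE !wtE -big_split /=; apply: eq_bigr => j _.
by rewrite mnmDE mulnDr.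
Qed.

Lemma wtM u q : wt (u *+ q) = (wt u *+ q)%MM.
Proof.
apply/mnmP => i; rewrite mulmnE !wtE big_distrl /=; apply: eq_bigr => j _.
by rewrite mulmnE mulnA.
Qed.

Lemma wt1 j : wt U_(j) = tnth a j.
Proof.
apply/mnmP => i; rewrite wtE (bigD1 j) //= mnm1E eqxx muln1 big1 ?addn0 // => k kj.
by rewrite mnm1E eq_sym (negbTE kj) muln0.
Qed.

Lemma mdeg_wt u : mdeg (wt u) = (d * mdeg u)%N.
Proof.
rewrite /wt mdeg_sum mdegE big_distrr; apply: eq_bigr => j _ /=.
rewrite mdegMn; case: ha => _ /(_ (tnth a j)).
by rewrite mem_tnth => /esym/eqP ->.
Qed.

Lemma wt_exists c v : (d * c <= mdeg v)%N ->
  exists2 u, mdeg u = c & (wt u <= v)%MM.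
Proof.
elim: c v => [|c IHc] v dv.
  by exists 0%MM; rewrite ?mdeg0 //; apply/mnm_lepP => i;
    rewrite wtE big1 // => j _; rewrite mnm0E muln0.
have [|y yv dy] := @sub_mdeg_exists n d v.
  by rewrite (leq_trans _ dv) // mulnS leq_addr.
have ya : y \in a by case: ha => _ ->; rewrite dy.
have [|u uc uv] := IHc (v - y)%MM.
  have := congr1 (@mdeg n) (submK yv); rewrite mdegD dy => vE.
  by rewrite -(leq_add2r d) vE addnC -mulnS.
have /tnthP[j yE] := ya.
exists (u + U_(j))%MM; first by rewrite mdegD mdeg1 uc addn1.
rewrite wtD wt1 -yE -[X in (_ <= X)%MM](submK yv); apply/mnm_lepP => i.
by rewrite [in X in (_ <= X)%N]mnmDE mnmDE leq_add2r; apply/mnm_lepP.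
Qed.

(** The exponent [u] is built digit by digit; each digit contributes a multinomial coefficient of
    order below p, and these multiply without cancellation. *)
Lemma fexp_wt m v : fexp d p m v ->
  exists u, [/\ (sumX l p ^+ m)@_u != 0, fexp d p m (wt u) & (wt u <= v)%MM].
Proof.
elim=> [{}v|c {}m v0 v1 {}v cp dv0 _ [u1 [Z1 f1 /mnm_lepP le1]] /mnm_lepP lev].
  exists 0%MM; rewrite expr0 mcoeff1 eqxx oner_neq0; split=> //; first exact: Fexp0.
  by apply/mnm_lepP => i; rewrite wtE big1 // => j _; rewrite mnm0E muln0.
have [u0 u0c /mnm_lepP le0] := wt_exists dv0.
exists (u0 + u1 *+ p)%MM; split.
- by rewrite sumX_frob_mcoeff // mulf_neq0 ?expf_neq0 // sumX_digit_neq0.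
- rewrite wtD wtM; apply: FexpS f1 (lepm_refl _) => //.
  by rewrite mdeg_wt u0c.
- apply/mnm_lepP => i; rewrite wtD wtM mnmDE mulmnE.
  apply: leq_trans (lev i); rewrite mnmDE mulmnE.
  by rewrite leq_add // leq_mul2r le1 orbT.
Qed.

(** The exponent [wt u] has degree d m <= d p^e, so its integral part after division by p^e has
    degree at most d. *)
Lemma rexp_deg m e (v : 'X_{1..n}) : (m <= p ^ e)%N -> rexp d p m e v ->
  exists v' : 'X_{1..n}, [/\ (v' <= v)%MM, rexp d p m e v' & (mdeg v' <= d)%N].
Proof.
move=> me [w fw ltw]; have [u [Zu fu /mnm_lepP uw]] := fexp_wt fw.
have q_gt0 : (0 < p ^ e)%N by rewrite expn_gt0 prime_gt0.
exists (mdivn (wt u) (p ^ e)); split.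
- apply/mnm_lepP => i; rewrite mnmE -ltnS ltn_divLR // mulnC.
  exact: leq_ltn_trans (uw i) (ltw i).
- by exists (wt u) => // i; rewrite mnmE mulnC ltn_ceil.
rewrite -(leq_pmul2r q_gt0); apply: (@leq_trans (mdeg (wt u))).
  rewrite !mdegE big_distrl leq_sum // => i _.
  by rewrite mnmE leq_trunc_div.
by rewrite mdeg_wt (sumX_homog Zu) leq_mul2l me orbT.
Qed.

End Generators.

(** * Monomial ideals *)

Definition upset (n : nat) (P : 'X_{1..n} -> Prop) : Prop :=
  forall v w, (v <= w)%MM -> P v -> P w.

(** Encoded by supports rather than generators, so that membership is decided one monomial at a
    time; it is an ideal when [P] is an [upset]. *)
Definition mon_ideal (n : nat) (k : fieldType) (P : 'X_{1..n} -> Prop) :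
    set {mpoly k[n]} :=
  [set f | forall v, v \in msupp f -> P v].

Arguments mon_ideal {n} k P.

Section MonomialIdeals.
Variables (n : nat) (k : fieldType).
Implicit Types (P Q : 'X_{1..n} -> Prop) (f g : {mpoly k[n]}) (v w : 'X_{1..n}).

Lemma eq_mon_ideal P Q : (forall v, P v <-> Q v) -> mon_ideal k P = mon_ideal k Q.
Proof. by move=> PQ; apply/seteqP; split=> f Pf v /Pf/PQ. Qed.

Lemma mon_ideal_ideal P : upset P -> is_ideal (mon_ideal k P).
Proof.
move=> upP; split=> [v|f g Pf Pg v|r f Pf v].
- by rewrite msupp0.
- by move/msuppD_le; rewrite mem_cat => /orP[/Pf|/Pg].
- move/msuppM_le => /allpairsP[[v1 v2] [/= _ /Pf Pv2 ->]].
  by apply: upP Pv2; apply: lem_addl.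
Qed.

Lemma mon_idealX P v : P v -> mon_ideal k P 'X_[v].
Proof. by move=> Pv w; rewrite msuppX inE => /eqP ->. Qed.

Lemma mon_ideal_sub P (J : set {mpoly k[n]}) : is_ideal J ->
  (mon_ideal k P `<=` J) <-> (forall v, P v -> J 'X_[v]).
Proof.
move=> Jid; split=> [PJ v Pv|PJ f Pf]; first by apply: PJ; apply: mon_idealX.
rewrite [f]mpolyE big_seq; apply: ideal_sum => // v /Pf/PJ JX.
by rewrite -mul_mpolyC; case: Jid => _ _; apply.
Qed.

Lemma mon_ideal_le P Q : (mon_ideal k P `<=` mon_ideal k Q) <-> (forall v, P v -> Q v).
Proof.
split=> [PQ v Pv|PQ f Pf v /Pf/PQ //].
by apply: (PQ _ (mon_idealX Pv)); rewrite msuppX inE.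
Qed.

Lemma gen_ideal_mon P (S : set {mpoly k[n]}) : upset P ->
  S `<=` mon_ideal k P -> (forall v, P v -> gen_ideal S 'X_[v]) ->
  gen_ideal S = mon_ideal k P.
Proof.
move=> upP SP PS; apply/seteqP; split.
  by apply/gen_ideal_sub => //; apply: mon_ideal_ideal.
by apply/mon_ideal_sub => //; apply: gen_ideal_ideal.
Qed.

Lemma idealX_up (J : set {mpoly k[n]}) v w :
  is_ideal J -> (v <= w)%MM -> J 'X_[v] -> J 'X_[w].
Proof. by case=> _ _ JM vw; rewrite -(submK vw) mpolyXD; apply: JM. Qed.

Lemma mul_mon_ideal P Q : upset P -> upset Q ->
  mul_ideal (mon_ideal k P) (mon_ideal k Q) =
  mon_ideal k (fun v => exists v1 v2, [/\ P v1, Q v2 & (v1 + v2 <= v)%MM]).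
Proof.
move=> upP upQ; apply: gen_ideal_mon => [v w vw [v1 [v2 [? ? le]]]|_ [f [g [Pf Qg ->]]] v|v].
- by exists v1, v2; split=> //; apply: lepm_trans vw.
- move=> /msuppM_le /allpairsP[[v1 v2] [/= /Pf ? /Qg ? ->]].
  by exists v1, v2; rewrite lepm_refl.
move=> [v1 [v2 [Pv1 Qv2 le]]]; apply: idealX_up le _; first exact: gen_ideal_ideal.
by apply: sub_gen_ideal; exists 'X_[v1], 'X_[v2]; rewrite mpolyXD; split=> //;
  apply: mon_idealX.
Qed.

Lemma maxidE : @maxid n k = mon_ideal k (fun v => (0 < mdeg v)%N).
Proof.
apply: gen_ideal_mon => [v w vw|_ [i _ <-] v|v].
- by move/leq_trans; apply; rewrite -(submK vw) mdegD leq_addl.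
- by rewrite msuppX inE => /eqP ->; rewrite mdeg1.
move=> /(@sub_mdeg_exists n 1)[y yv /eqP/mdeg1P[i /eqP yE]].
apply: idealX_up yv _; first exact: gen_ideal_ideal.
by apply: sub_gen_ideal; exists i => //; rewrite yE.
Qed.

Lemma upset_mdeg m : upset (fun v : 'X_{1..n} => (m <= mdeg v)%N).
Proof. by move=> v w vw /leq_trans; apply; rewrite -(submK vw) mdegD leq_addl. Qed.

Lemma exp_mdeg_ideal d m :
  exp_ideal (mon_ideal k (fun v => (d <= mdeg v)%N)) m =
  mon_ideal k (fun v => (d * m <= mdeg v)%N).
Proof.
elim: m => [|m IHm] /=.
  by apply/seteqP; split=> // f _ v _; rewrite muln0.
rewrite -/(exp_ideal _ m) IHm mul_mon_ideal; try exact: upset_mdeg.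
apply: eq_mon_ideal => v; split=> [[v1 [v2 [d1 d2 le]]]|dv].
  by apply: upset_mdeg le _; rewrite mdegD mulnS leq_add.
have [|y yv dy] := @sub_mdeg_exists n d v.
  by apply: leq_trans dv; rewrite mulnS leq_addr.
exists y, (v - y)%MM; rewrite addmC submK // lepm_refl dy; split=> //.
have := congr1 (@mdeg n) (submK yv); rewrite mdegD dy => vE.
by rewrite -(leq_add2r d) vE addnC -mulnS.
Qed.

Lemma exp_maxidE d : exp_ideal (@maxid n k) d = mon_ideal k (fun v => (d <= mdeg v)%N).
Proof. by rewrite maxidE exp_mdeg_ideal; apply: eq_mon_ideal => v; rewrite mul1n. Qed.

End MonomialIdeals.

(** * Frobenius powers and roots of monomial ideals *)

Section FrobeniusMonomial.
Variables (n p : nat) (k : fieldType).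
Hypothesis pchark : p \in [pchar k].
Implicit Types (P Q : 'X_{1..n} -> Prop) (f g : {mpoly k[n]}) (v w : 'X_{1..n}).

Let p_prime : prime p. Proof. exact: pcharf_prime pchark. Qed.
Let pcharA : p \in [pchar {mpoly k[n]}]. Proof. exact: pchar_mpoly. Qed.
Let q_gt0 e : (0 < p ^ e)%N. Proof. exact: exp_pe_gt0 pchark e. Qed.

Lemma frob_mon_ideal e P : upset P ->
  frob_ideal p e (mon_ideal k P) =
  mon_ideal k (fun v => exists2 w, P w & (w *+ (p ^ e) <= v)%MM).
Proof.
move=> upP; apply: gen_ideal_mon => [v w vw [u Pu le]|_ [f Pf <-] v|v [w Pw le]].
- by exists u => //; apply: lepm_trans vw.
- rewrite mpoly_frobE // => /msupp_sum_le/flattenP[_ /mapP[u us ->]].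
  move/msuppZ_le; rewrite msuppX inE => /eqP ->; exists u; last exact: lepm_refl.
  by apply: Pf; move: us; rewrite mem_filter.
apply: idealX_up le _; first exact: gen_ideal_ideal.
by apply: sub_gen_ideal; exists 'X_[w]; [apply: mon_idealX|rewrite mpolyXn].
Qed.

Lemma frob_pow_natE d m :
  frob_pow_nat p (exp_ideal (@maxid n k) d) m = mon_ideal k (fexp d p m).
Proof.
have p_gt1 := prime_gt1 p_prime.
(* Generalized to the tail of the product that starts at digit [j]: it is
   ((m^d)^[m div p^j])^[p^j]. *)
suff E K j : (m < p ^ (j + K))%N ->
    foldr (@mul_ideal {mpoly k[n]}) setT
      [seq frob_ideal p i (exp_ideal (exp_ideal (@maxid n k) d) (digit p m i))
         | i <- iota j K] =
    mon_ideal k (fun v => exists2 w, fexp d p (m %/ p ^ j) w & (w *+ (p ^ j) <= v)%MM).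
  rewrite /frob_pow_nat E ?add0n ?trunc_log_ltn //.
  apply: eq_mon_ideal => v; rewrite expn0 divn1; split=> [[w fw]|fv].
    by rewrite mulm1n => le; apply: fexp_up fw.
  by exists v; rewrite ?mulm1n ?lepm_refl.
elim: K j => [|K IHK] j mlt /=.
  rewrite addn0 in mlt; apply/seteqP; split=> // f _ v _; exists 0%MM.
    by rewrite divn_small //; apply: Fexp0.
  by apply/mnm_lepP => i; rewrite mulmnE mnm0E.
rewrite IHK; last by rewrite addSnnS.
rewrite exp_maxidE exp_mdeg_ideal frob_mon_ideal; last exact: upset_mdeg.
rewrite mul_mon_ideal.
- apply: eq_mon_ideal => v; split.
    move=> [x0 [x1 [[v0 dv0 /mnm_lepP le0] [v1 fv1 /mnm_lepP le1] /mnm_lepP le]]].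
    exists (v0 + v1 *+ p)%MM.
      apply/fexpP => //; exists v0, v1; rewrite lepm_refl; split=> //.
      by rewrite -divnMA -expnSr.
    apply/mnm_lepP => i; move: (le0 i) (le1 i) (le i).
    by rewrite !(mnmDE, mulmnE) expnSr; nia.
  move=> [w /(fexpP _ p_gt1)[v0 [v1 [dv0 fv1 /mnm_lepP lew]]] /mnm_lepP le].
  exists (v0 *+ (p ^ j))%MM, (v1 *+ (p ^ j.+1))%MM; split.
  + by exists v0; rewrite ?lepm_refl.
  + by exists v1; rewrite ?lepm_refl // expnSr divnMA.
  + apply/mnm_lepP => i; move: (lew i) (le i).
    by rewrite !(mnmDE, mulmnE) expnSr; nia.
- by move=> v w vw [u ? le]; exists u => //; apply: lepm_trans vw.
- by move=> v w vw [u ? le]; exists u => //; apply: lepm_trans vw.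
Qed.

Lemma mcoeff_frob e f u :
  (f ^+ (p ^ e))@_u =
  if (mdivn u (p ^ e) *+ (p ^ e))%MM == u then f@_(mdivn u (p ^ e)) ^+ (p ^ e) else 0.
Proof.
set q := (p ^ e)%N; set d := mdivn u q.
have dK w : mdivn (w *+ q)%MM q = w.
  by apply/mnmP => i; rewrite mnmE mulmnE mulnK // q_gt0.
rewrite mpoly_frobE // raddf_sum /=.
have E w : (f@_w ^+ q *: 'X_[k, w *+ q])@_u =
    if w == d then (if (d *+ q)%MM == u then f@_d ^+ q else 0) else 0.
  rewrite mcoeffZ mcoeffX; have [->|wd] := eqVneq w d.
    by case: eqP; rewrite ?mulr1 ?mulr0.
  by case: eqP => [uE|_]; rewrite ?mulr0 // /d -uE dK eqxx in wd *.
rewrite (eq_bigr _ (fun w _ => E w)) -big_mkcond /=.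
have [ds|ds] := boolP (d \in msupp f).
  by rewrite -big_filter filter_pred1_uniq ?msupp_uniq // big_seq1.
rewrite (memN_msupp_eq0 ds) expr0n gtn_eqF ?q_gt0 // if_same big1 //.
Qed.

Section LiftDual.
Variables (e : nat) (T : finType) (c : T -> k -> k) (b : T -> k).
Hypothesis cb : frob_dual (p ^ e) c b.

Local Notation q := (p ^ e)%N.

Definition mbox (r : {ffun 'I_n -> 'I_q}) : 'X_{1..n} := [multinom (r i : nat) | i < n].

Definition mmodn v : {ffun 'I_n -> 'I_q} :=
  [ffun i => Ordinal (ltn_pmod (v i) (q_gt0 e))].

Lemma mbox_eq v w r : (v == mbox r + w *+ q)%MM = (mmodn v == r) && (mdivn v q == w).
Proof.
apply/eqP/andP => [->|[/eqP <- /eqP <-]].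
  split; apply/eqP.
    apply/ffunP => i; apply: val_inj; rewrite ffunE /= mnmDE mulmnE mnmE.
    by rewrite addnC modnMDl modn_small.
  apply/mnmP => i; rewrite mnmE mnmDE mulmnE mnmE addnC divnMDl ?q_gt0 //.
  by rewrite divn_small ?addn0.
by apply/mnmP => i; rewrite mnmDE mulmnE !mnmE ffunE /= addnC -divn_eq.
Qed.

(** Coordinates on k with respect to the b_i give coordinates on k[x] with respect to the b_i x^r,
    all entries of r being < p^e: the one at (i, r) collects the exponents congruent to r modulo
    p^e. *)
Definition lift_coord (ir : T * {ffun 'I_n -> 'I_q}) f : {mpoly k[n]} :=
  \sum_(v <- msupp f) if mmodn v == ir.2 then c ir.1 f@_v *: 'X_[mdivn v q] else 0.

Lemma coord0 i : c i 0 = 0.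
Proof.
have [cD _ _] := cb; have /(congr1 (fun z => z - c i 0)) := cD i 0 0.
by rewrite addr0 addrK subrr => <-.
Qed.

Lemma mcoeff_lift_coord i r f w :
  (lift_coord (i, r) f)@_w = c i f@_(mbox r + w *+ q).
Proof.
rewrite /lift_coord raddf_sum /=; set u := (_ + _)%MM.
have E v : (if mmodn v == r then c i f@_v *: 'X_[k, mdivn v q] else 0)@_w =
    if v == u then c i f@_u else 0.
  have := mbox_eq v w r; rewrite -/u; case: (eqVneq v u) => [-> /esym/andP[-> /eqP ->]|].
    by rewrite mcoeffZ mcoeffX eqxx mulr1.
  move=> _; case: ifP; rewrite ?mcoeff0 // => _ /= /esym/negbT/negbTE nw.
  by rewrite mcoeffZ mcoeffX nw mulr0.
rewrite (eq_bigr _ (fun w _ => E w)) -big_mkcond /=.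
have [ds|ds] := boolP (u \in msupp f).
  by rewrite -big_filter filter_pred1_uniq ?msupp_uniq // big_seq1.
by rewrite (memN_msupp_eq0 ds) coord0 big1.
Qed.

Lemma lift_frob_dual :
  frob_dual q lift_coord (fun ir => b ir.1 *: 'X_[mbox ir.2]).
Proof.
have [cD cM cE] := cb.
split=> [[i r] f g|[i r] f g|f].
- by apply/mpolyP => w; rewrite mcoeffD !mcoeff_lift_coord mcoeffD cD.
- apply/mpolyP => w; rewrite mcoeff_lift_coord mpoly_frobE //.
  rewrite [in RHS](mpolyE f) !mulr_suml !raddf_sum (big_morph _ (cD i) (coord0 i)) /=.
  apply: eq_bigr => m _; rewrite -!scalerAl !mcoeffZ cM; congr (_ * _).
  rewrite !['X_[_] * _]mulrC !mcoeffMXE.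
  have -> : (m *+ q <= mbox r + w *+ q)%MM = (m <= w)%MM.
    apply/mnm_lepP/mnm_lepP => le j; move: (le j); rewrite !(mnmDE, mulmnE) mnmE.
      move=> lej; rewrite leqNgt; apply/negP; rewrite -(leq_pmul2r (q_gt0 e)) mulSn.
      by move=> le1; have := leq_trans le1 lej; rewrite leq_add2r leqNgt ltn_ord.
    by move=> lej; apply: leq_trans (leq_addl _ _); rewrite leq_mul2r lej orbT.
  case: ifPn => [/mnm_lepP mw|_]; last exact: coord0.
  rewrite mcoeff_lift_coord; congr (c i _@_ _); apply/mnmP => j.
  by rewrite !(mnmBE, mnmDE, mulmnE) mulnBl addnBA // leq_mul2r mw orbT.
apply/mpolyP => w; rewrite raddf_sum /=.
rewrite -(pair_bigA _ (fun i r => (lift_coord (i, r) f ^+ q * (b i *: 'X_[mbox r]))@_w)) /=.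
rewrite [LHS]cE; apply: eq_bigr => i _; rewrite (bigD1 (mmodn w)) //= big1 => [|r rw].
  rewrite addr0 -scalerAr mcoeffZ mcoeffMXE.
  have /eqP wE : w == (mbox (mmodn w) + mdivn w q *+ q)%MM by rewrite mbox_eq !eqxx.
  have wE' : (w - mbox (mmodn w) = mdivn w q *+ q)%MM by rewrite {1}wE addmC addmK.
  have -> : (mbox (mmodn w) <= w)%MM by rewrite {2}wE lem_addr.
  rewrite mcoeff_frob wE'.
  have -> : mdivn (mdivn w q *+ q)%MM q = mdivn w q.
    by apply/mnmP => j; rewrite mnmE mulmnE mulnK // q_gt0.
  by rewrite eqxx mcoeff_lift_coord -wE mulrC.
rewrite -scalerAr mcoeffZ mcoeffMXE; case: ifPn => [le|_]; last by rewrite mulr0.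
rewrite mcoeff_frob; case: eqP => [wE|_]; last by rewrite mulr0.
move: rw; suff : w == (mbox r + mdivn (w - mbox r) q *+ q)%MM.
  by rewrite mbox_eq => /andP[/eqP -> _]; rewrite eqxx.
by rewrite wE addmC submK.
Qed.

Lemma lift_coordX i w :
  lift_coord (i, mmodn w) 'X_[w] = c i 1 *: 'X_[mdivn w q].
Proof.
apply/mpolyP => u; rewrite mcoeff_lift_coord mcoeffZ !mcoeffX mbox_eq eqxx /=.
by case: eqP; rewrite ?mulr1 ?mulr0 ?coord0.
Qed.

Lemma frob_root_mon_ideal P : upset P ->
  frob_root p e (mon_ideal k P) =
  mon_ideal k (fun v => exists2 w, P w & forall i, (w i < q * (v i).+1)%N).
Proof.
move=> upP; apply/seteqP; split.
  have upQ : upset (fun v => exists2 w, P w & forall i, (w i < q * (v i).+1)%N).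
    move=> v w /mnm_lepP vw [u Pu ltu]; exists u => // i.
    by apply: leq_trans (ltu i) _; rewrite leq_mul2l ltnS vw orbT.
  apply: frob_root_min; first exact: mon_ideal_ideal.
  rewrite frob_mon_ideal //; apply/mon_ideal_le => w Pw.
  exists (mdivn w q).
    by exists w => // i; rewrite mnmE mulnC ltn_ceil ?q_gt0.
  by apply/mnm_lepP => i; rewrite mulmnE mnmE leq_trunc_div.
have Rid := frob_root_ideal p e (mon_ideal k P).
apply/mon_ideal_sub => // v [w Pw ltw].
have vw : (mdivn w q <= v)%MM.
  apply/mnm_lepP => i; rewrite mnmE -ltnS ltn_divLR ?q_gt0 // mulnC; exact: ltw.
apply: (idealX_up Rid vw).
(* Since 1 is the sum of the c_i(1)^q b_i, some c_i(1) is nonzero; this coordinate sends x^w to a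
   nonzero multiple of x^floor(w/q). *)
have [i ci] : exists i, c i 1 != 0.
  apply/existsP; rewrite -[[exists _, _]]negbK negb_exists; apply/negP => /forallP c0.
  have [_ _ cE] := cb; have /eqP := cE 1.
  rewrite big1 ?oner_eq0 // => i _; move: (c0 i); rewrite negbK => /eqP ->.
  by rewrite expr0n gtn_eqF ?q_gt0 // mul0r.
have := frob_dual_root lift_frob_dual (i, mmodn w) (@mon_idealX n k P w Pw).
rewrite lift_coordX => Rw; case: Rid => _ _ /(_ (c i 1)^-1%:MP _ Rw).
by rewrite mul_mpolyC scalerA mulVf // scale1r.
Qed.

Lemma frob_pow_ratE d m :
  frob_pow_rat p (exp_ideal (@maxid n k) d) m e = mon_ideal k (rexp d p m e).
Proof.
rewrite /frob_pow_rat frob_pow_natE frob_root_mon_ideal // => v w vw.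
by apply: fexp_up => //; apply: prime_gt1.
Qed.

End LiftDual.
End FrobeniusMonomial.

(** * Critical exponents of m^d *)

Lemma seq_uniform_bound (X : eqType) (Q : nat -> X -> Prop) (s : seq X) :
  (forall e e' x, (e <= e')%N -> Q e x -> Q e' x) ->
  (forall x, x \in s -> exists e, Q e x) ->
  exists e, forall x, x \in s -> Q e x.
Proof.
move=> Qm; elim: s => [|y s IHs] Qs; first by exists 0%N.
have [e1 Q1] := Qs y (mem_head _ _).
have [|e2 Q2] := IHs; first by move=> x xs; apply: Qs; rewrite inE xs orbT.
exists (maxn e1 e2) => x; rewrite inE => /predU1P[->|/Q2].
  by apply: Qm Q1; apply: leq_maxl.
by apply: Qm; apply: leq_maxr.
Qed.

(** * The integers ceil(t p^e) *)

Section CeilScaled.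
Variables (R : realType) (p : nat).
Hypothesis p_gt1 : (1 < p)%N.
Implicit Types (t lambda mu : R) (e i j s : nat).

Local Notation M := (@ceil_scaled p R).

Let pe_gt0 e : 0 < (p ^ e)%:R :> R.
Proof. by rewrite ltr0n expn_gt0 ltnW. Qed.

Lemma ceil_scaled_le t e j : 0 <= t -> (M t e <= j)%N = (t * (p ^ e)%:R <= j%:R).
Proof.
move=> t0; rewrite /ceil_scaled -lez_nat gez0_abs ?ceil_le_int //.
by rewrite ceil_ge0 (lt_le_trans (ltrN10 _)) // mulr_ge0 // ltW.
Qed.

Lemma ltn_ceil_scaled t e j : 0 <= t -> (j < M t e)%N = (j%:R < t * (p ^ e)%:R).
Proof. by move=> t0; rewrite ltnNge ceil_scaled_le // ltNge. Qed.

Lemma ceil_scaled_gt0 t e : 0 < t -> (0 < M t e)%N.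
Proof. by move=> t0; rewrite ltn_ceil_scaled ?ltW // mulr_gt0. Qed.

Lemma ceil_scaled_pred_lt t e : 0 < t -> (M t e).-1%:R < t * (p ^ e)%:R.
Proof. by move=> t0; rewrite -ltn_ceil_scaled ?ltW // prednK ?ceil_scaled_gt0. Qed.

Lemma ceil_scaled_ge t e : 0 <= t -> t * (p ^ e)%:R <= (M t e)%:R.
Proof. by move=> t0; rewrite -ceil_scaled_le. Qed.

Lemma ceil_scaledS t e : 0 <= t -> (M t e.+1 <= p * M t e)%N.
Proof.
move=> t0; rewrite ceil_scaled_le // expnS !natrM mulrCA ler_wpM2l ?ler0n //.
exact: ceil_scaled_ge.
Qed.

Lemma ceil_scaled_mono t t' e : 0 <= t -> t <= t' -> (M t e <= M t' e)%N.
Proof.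
move=> t0 tt'; have t'0 := le_trans t0 tt'.
rewrite ceil_scaled_le //; apply: le_trans (ceil_scaled_ge e t'0).
by rewrite ler_wpM2r // ltW.
Qed.

Lemma ceil_scaled_le1 t e : 0 < t <= 1 -> (M t e <= p ^ e)%N.
Proof. by case/andP=> t0 t1; rewrite ceil_scaled_le ?(ltW t0) // ler_piMl // ltW. Qed.

Lemma ceil_scaled_nat s e : M s%:R e = (s * p ^ e)%N.
Proof.
apply/eqP; rewrite eqn_leq ceil_scaled_le ?ler0n // natrM lexx /=.
by rewrite -(ler_nat R) natrM ceil_scaled_ge ?ler0n.
Qed.

Lemma ceil_scaled_shift lambda mu s j e : 0 <= lambda -> 0 <= mu ->
  lambda * (p ^ j)%:R = s%:R + mu -> M lambda (e + j) = (s * p ^ e + M mu e)%N.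
Proof.
move=> l0 m0 E; have E' : lambda * (p ^ (e + j))%:R = (s * p ^ e)%:R + mu * (p ^ e)%:R.
  by rewrite expnD natrM mulrCA E mulrDr natrM mulrC [in X in _ + X]mulrC.
apply/eqP; rewrite eqn_leq; apply/andP; split.
  by rewrite ceil_scaled_le // E' natrD lerD2l ceil_scaled_ge.
have sM : (s * p ^ e <= M lambda (e + j))%N.
  rewrite -(ler_nat R); apply: le_trans (ceil_scaled_ge _ l0).
  by rewrite E' lerDl mulr_ge0 // ltW.
rewrite -(subnKC sM) leq_add2l ceil_scaled_le // natrB // lerBrDl -E'.
exact: ceil_scaled_ge.
Qed.

Lemma archi_exp_pe t : 0 < t -> exists e0, forall e, (e0 <= e)%N -> 1 <= t * (p ^ e)%:R.
Proof.
move=> t0; have ti0 : 0 <= t^-1 by rewrite invr_ge0 ltW.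
exists (M t^-1 0) => e le; rewrite -ler_pdivrMl // mulr1.
have := ceil_scaled_ge 0 ti0; rewrite expn0 mulr1 => /le_trans; apply.
by rewrite ler_nat (leq_trans le) // ltnW // ltn_expl.
Qed.

Lemma ceil_scaled_lt1 t : 0 < t < 1 ->
  exists e0, forall e, (e0 <= e)%N -> (M t e < p ^ e)%N.
Proof.
move=> /andP[t0 t1]; have [|e0 He] := @archi_exp_pe (1 - t); first by rewrite subr_gt0.
exists e0 => e /He; rewrite mulrBl mul1r lerBrDr -lerBrDl => h.
have pe : (0 < p ^ e)%N by rewrite expn_gt0 ltnW.
by rewrite -(prednK pe) ltnS ceil_scaled_le ?(ltW t0) // -subn1 natrB.
Qed.

(** For such e, t <= (ceil(t' p^e) - 1) / p^e < t'; hence jumps at t' can be tested on these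
    fractions alone. *)
Lemma ceil_scaled_gap t t' : 0 <= t -> t < t' ->
  exists e0, forall e, (e0 <= e)%N -> (M t e < M t' e)%N.
Proof.
move=> t0 tt'; have [|e0 He] := @archi_exp_pe (t' - t); first by rewrite subr_gt0.
exists e0 => e /He; rewrite mulrBl lerBrDr => h.
rewrite ltn_ceil_scaled ?(ltW (le_lt_trans t0 tt')) //; apply: lt_le_trans h.
have [->|M_gt0] := posnP (M t e); first by rewrite ltr_wpDr // mulr_ge0 // ltW.
by rewrite -[M t e]prednK // -natr1 addrC ltrD2l -ltn_ceil_scaled // prednK.
Qed.

End CeilScaled.

Section CriticalExponents.
Variables (R : realType) (n d p : nat).
Hypothesis p_prime : prime p.
Implicit Types (t lambda mu : R) (v w y : 'X_{1..n}) (e j s : nat).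

Let p_gt1 : (1 < p)%N. Proof. exact: prime_gt1. Qed.

Local Notation M := (@ceil_scaled p R).

(* Membership of [v] in the monomial ideal (m^d)^[t]. *)
Definition frob_pow_exp t v : Prop := exists e, rexp d p (M t e) e v.

(* Whether [lambda] is critical for m^d, read off from the exponents: the
   largest multiple of p^(-e) below [lambda] is (M lambda e).-1 / p^e. *)
Definition crit_exp lambda : Prop := forall e,
  exists2 v : 'X_{1..n}, rexp d p (M lambda e).-1 e v & ~ frob_pow_exp lambda v.

Lemma frob_pow_exp_up t : upset (frob_pow_exp t).
Proof. by move=> v w vw [e re]; exists e; apply: rexp_up re. Qed.

Lemma rexp_ceil_mono t e e' v : 0 <= t -> (e <= e')%N ->
  rexp d p (M t e) e v -> rexp d p (M t e') e' v.
Proof.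
move=> t0 /subnK <-; elim: (e' - e)%N => [//|j IHj] /IHj.
by apply: rexp_step => //; apply: ceil_scaledS.
Qed.

(** At a fraction m/p^e the increasing chain that defines the Frobenius power is constant from level
    e on, because the later levels use m p^j / p^(e+j). *)
Lemma frob_pow_exp_pred lambda e v : 0 < lambda ->
  frob_pow_exp ((M lambda e).-1%:R / (p ^ e)%:R) v -> rexp d p (M lambda e).-1 e v.
Proof.
set m := (M lambda e).-1; set t := m%:R / _ => l0 [e' r'].
have pe0 : (p ^ e)%:R != 0 :> R by rewrite pnatr_eq0 -lt0n expn_gt0 ltnW.
have t0 : 0 <= t by rewrite divr_ge0 ?ler0n.
have := rexp_ceil_mono t0 (leq_maxl e' e) r'.
rewrite -(subnKC (leq_maxr e' e)); set j := (_ - e)%N.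
have -> : M t (e + j) = (m * p ^ j)%N.
  rewrite addnC (@ceil_scaled_shift R p t 0 m e j) // ?addr0 ?divfK //.
  by rewrite -[0 : R]/(0%:R) ceil_scaled_nat // mul0n addn0.
exact: rexp_frob.
Qed.

(** A witness [v] for [lambda] at level e + j splits into [w0], belonging to the digits of [s], and
    a witness [y] for [mu] at level e. If [y] were in (m^d)^[mu], joining [w0] again would put [v]
    in (m^d)^[lambda]. *)
Lemma crit_exp_shift lambda mu s j : 0 < lambda -> 0 < mu < 1 ->
  lambda * (p ^ j)%:R = s%:R + mu -> crit_exp lambda -> crit_exp mu.
Proof.
move=> l0 /andP[m0 m1] E crit e; have [v] := crit (e + j)%N.
have Eshift e' : M lambda (e' + j) = (s * p ^ e' + M mu e')%N.
  by apply: ceil_scaled_shift => //; apply: ltW.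
have M0 := ceil_scaled_gt0 p_gt1 e m0.
have Mlt : ((M mu e).-1 < p ^ e)%N by rewrite prednK // ceil_scaled_le1 // m0 ltW.
rewrite Eshift -(prednK M0) addnS /= => /rexp_split[//|//|w0 [y [fw0 ry lt]]] Nv.
exists y => // -[e1 r1]; apply: Nv.
(* Joining the digits requires ceil(mu p^e) < p^e, which mu < 1 ensures only for large e. *)
have [|e2 lt2] := @ceil_scaled_lt1 R p p_gt1 mu; first by rewrite m0 m1.
set e3 := maxn e1 e2; exists (e3 + j)%N; rewrite Eshift.
apply/rexp_split => //; first by apply: lt2; apply: leq_maxr.
exists w0, y; split=> //.
by apply: rexp_ceil_mono r1; [apply: ltW|apply: leq_maxl].
Qed.

(** Supplied later by [rexp_deg]; as a hypothesis it keeps the list of monomials out of this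
    section. *)
Hypothesis rexp_bound : forall m e v, (m <= p ^ e)%N -> rexp d p m e v ->
  exists v' : 'X_{1..n}, [/\ (v' <= v)%MM, rexp d p m e v' & (mdeg v' <= d)%N].

(** If lambda < mu, a fraction m/p^e lies in [lambda, mu). A witness for [mu] at level e can be
    taken of degree at most d; it then lies in (m^d)^[lambda] but not in (m^d)^[mu]. *)
Lemma crit_exp_inj lambda mu : 0 < lambda < 1 -> 0 < mu < 1 ->
  crit_exp lambda -> crit_exp mu ->
  (forall v, (mdeg v <= d)%N -> frob_pow_exp lambda v <-> frob_pow_exp mu v) ->
  lambda = mu.
Proof.
wlog lm : lambda mu / lambda < mu => [hwlog l01 m01 cl cm E|].
  have [lm|ml|//] := ltgtP lambda mu; first exact: hwlog.
  by apply/esym/hwlog => // v dv; split=> /(E v dv).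
move=> /andP[l0 l1] /andP[m0 m1] _ cm E.
have [e /(_ e (leqnn e)) lt] := ceil_scaled_gap p_gt1 (ltW l0) lm.
have [v rv Nv] := cm e; have [|v' [v'v rv' dv']] := rexp_bound _ rv.
  by rewrite (leq_trans (leq_pred _)) // ceil_scaled_le1 // m0 ltW.
case: Nv; apply: frob_pow_exp_up v'v _; apply/E => //; exists e.
by apply: rexp_mono rv' => //; rewrite -ltnS prednK // (leq_trans _ lt).
Qed.

(** By [crit_exp_inj] a critical exponent in (0,1) is determined by a set of exponents of degree at
    most d. The map [next] is the base p shift with remainder in (0,1]. *)
Lemma crit_exp_finite : exists (T : finType) (F : T -> R) (next : T -> T),
  [/\ forall i, 0 < F i <= 1,
      forall i, F i = 1 \/ crit_exp (F i),
      forall mu, 0 < mu < 1 -> crit_exp mu -> exists i, F i = mu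
    & forall i, F i * p%:R = (M (F i) 1).-1%:R + F (next i)].
Proof.
pose code mu : {ffun 'X_{1..n < d.+1} -> bool} :=
  [ffun v : 'X_{1..n < d.+1} => `[< frob_pow_exp mu v >]].
pose good mu := [/\ 0 < mu < 1 & crit_exp mu].
(* Codes that come from no critical exponent are sent to 1, and so is [None]: the shift can land on
   1, which must therefore be in the family. *)
pose F (o : option {ffun 'X_{1..n < d.+1} -> bool}) : R :=
  if o is Some s then
    if pselect (exists mu, good mu /\ code mu = s) is left h then projT1 (cid h) else 1
  else 1.
have F1 i : F i = 1 \/ good (F i).
  case: i => [s|]; last by left.
  rewrite /F; case: pselect => [h|_]; last by left.
  by case: (cid h) => mu [gmu _] /=; right.
have Fgood mu : good mu -> exists i, F i = mu.
  move=> gmu; exists (Some (code mu)); rewrite /F.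
  case: pselect => [h|]; last by case; exists mu.
  case: (cid h) => nu [gnu E] /=; case: gmu gnu => m01 cm [n01 cn].
  apply: crit_exp_inj => // v dv; have dv' : (mdeg v < d.+1)%N by [].
  have /ffunP/(_ (BMultinom dv')) := E; rewrite !ffunE /= => Eb.
  by split=> /asboolP; [rewrite Eb|rewrite -Eb] => /asboolP.
have F01 i : 0 < F i <= 1.
  by case: (F1 i) => [->|[/andP[-> /ltW ->]]]; rewrite ?ltr01 ?lexx.
have next i : exists i', F i * p%:R = (M (F i) 1).-1%:R + F i'.
  have /andP[f0 f1] := F01 i; set c := (M (F i) 1).-1.
  have c_lt : c%:R < F i * p%:R by have := ceil_scaled_pred_lt p_gt1 1 f0; rewrite expn1.
  have c_ge : F i * p%:R <= c%:R + 1.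
    have := ceil_scaled_ge p 1 (ltW f0); rewrite expn1 => /le_trans; apply.
    by rewrite natr1 prednK ?ceil_scaled_gt0.
  pose mu := F i * p%:R - c%:R; have mu0 : 0 < mu by rewrite subr_gt0.
  have muE : F i * p%:R = c%:R + mu by rewrite addrC subrK.
  suff [i' Fi'] : exists i', F i' = mu by exists i'; rewrite Fi'.
  have [mu1|] := eqVneq mu 1; first by exists None.
  rewrite neq_lt => /orP[mu1|]; last by rewrite ltrBrDl ltNge c_ge.
  apply: Fgood; split; first by rewrite mu0.
  apply: (@crit_exp_shift (F i) mu c 1) => //; rewrite ?mu0 ?expn1 //.
  (* If F i = 1, then c = p - 1 and the shift is 1 again, contrary to mu < 1. *)
  case: (F1 i) => [F1i|[]//]; move: mu1.
  have := ceil_scaled_nat R p 1 1; rewrite mul1n expn1 mulr1n => M1.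
  rewrite /mu /c F1i M1 mul1r.
  rewrite -subn1 natrB ?prime_gt0 // opprB addrC subrK ltxx //.
have [nx nxE] := choice next.
exists (option {ffun 'X_{1..n < d.+1} -> bool} : finType), F, nx; split=> // [x|mu m01 cm].
  by case: (F1 x) => [->|[]]; [left|right].
by apply: Fgood.
Qed.

Lemma crit_exp_frac lambda : 0 < lambda -> crit_exp lambda ->
  exists s mu, [/\ 0 < mu <= 1, lambda = s%:R + mu & mu = 1 \/ crit_exp mu].
Proof.
move=> l0 cl; have c_lt := ceil_scaled_pred_lt p_gt1 0 l0.
have c_ge := ceil_scaled_ge p 0 (ltW l0).
rewrite expn0 mulr1 in c_lt c_ge; set c := (M lambda 0).-1 in c_lt.
rewrite -[M lambda 0]prednK ?ceil_scaled_gt0 // -/c -natr1 in c_ge.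
(* With c = ceil(lambda) - 1 rather than the floor, the remainder is in (0,1] and an integral
   [lambda] gives mu = 1. *)
exists c, (lambda - c%:R); rewrite subr_gt0 c_lt lerBlDl c_ge addrC subrK.
split=> //; have [->|mu1] := eqVneq (lambda - c%:R) 1; [by left|right].
apply: (@crit_exp_shift lambda _ c 0) => //; last by rewrite expn0 mulr1 addrC subrK.
by rewrite subr_gt0 c_lt lt_neqAle mu1 lerBlDl c_ge.
Qed.

Section FrobeniusPower.
Variable k : fieldType.
Hypothesis pchark : p \in [pchar k].
Hypothesis dual : forall e, exists (T : finType) (c : T -> k -> k) (b : T -> k),
  frob_dual (p ^ e) c b.

Lemma frob_powE t : 0 <= t ->
  frob_pow p (exp_ideal (@maxid n k) d) t = mon_ideal k (frob_pow_exp t).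
Proof.
move=> t0; have E e : frob_pow_rat p (exp_ideal (@maxid n k) d) (M t e) e =
    mon_ideal k (rexp d p (M t e) e).
  by have [T [c [b cb]]] := dual e; apply: (frob_pow_ratE n pchark cb).
rewrite /frob_pow; apply/seteqP; split=> [f [e _]|f jf].
  by rewrite E => rf v /rf rv; exists e.
have [e e' v le|e re] := @seq_uniform_bound _ (fun e => rexp d p (M t e) e) (msupp f) _ jf.
  exact: rexp_ceil_mono.
by exists e; rewrite // E.
Qed.

Lemma critical_exponent_exp lambda :
  critical_exponent p (exp_ideal (@maxid n k) d) lambda -> crit_exp lambda.
Proof.
move=> [l0 crit] e; set m := (M lambda e).-1; set t : R := m%:R / (p ^ e)%:R.
have pe0 : 0 < (p ^ e)%:R :> R by rewrite ltr0n expn_gt0 ltnW.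
have t0 : 0 <= t by rewrite divr_ge0 ?ler0n.
have tl : t < lambda by rewrite ltr_pdivrMr // ceil_scaled_pred_lt.
have [|_] := crit (lambda - t); first by rewrite subr_gt0 tl gerBl.
rewrite subKr !frob_powE ?(ltW l0) //.
move=> /mon_ideal_le/existsNP[v /not_implyP[tv Nv]]; exists v => //.
exact: frob_pow_exp_pred.
Qed.

End FrobeniusPower.
End CriticalExponents.

(** * Bases of k over k^(p^e) *)

Section FieldDual.
Variables (k : fieldType) (p : nat).
Hypothesis pchark : p \in [pchar k].

Let p_prime : prime p. Proof. exact: pcharf_prime pchark. Qed.

Lemma frobB e (x y : k) : (x - y) ^+ (p ^ e) = x ^+ (p ^ e) - y ^+ (p ^ e).
Proof. by apply/eqP; rewrite eq_sym subr_eq -(frobD pchark) subrK. Qed.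

Lemma basis_frob_dual e (T : finType) (b : T -> k) :
  (forall x, exists c : T -> k, x = \sum_i c i ^+ (p ^ e) * b i) ->
  (forall c : T -> k, \sum_i c i ^+ (p ^ e) * b i = 0 -> forall i, c i = 0) ->
  exists2 c : T -> k -> k, frob_dual (p ^ e) c b &
    forall i j, c i (b j) = (i == j)%:R.
Proof.
move=> bspan bfree; have [c cE] := choice bspan.
have cP x (c' : T -> k) : x = \sum_i c' i ^+ (p ^ e) * b i -> c x =1 c'.
  move=> xE i; apply/eqP; rewrite -subr_eq0; apply/eqP.
  apply: (bfree (fun i => c x i - c' i)).
  by under eq_bigr do rewrite frobB mulrBl; rewrite sumrB -cE -xE subrr.
exists (fun i x => c x i) => [|i j]; first split=> [i x y|i r x|x].
- apply: (cP (x + y) (fun i => c x i + c y i)).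
  by under eq_bigr do rewrite (frobD pchark) mulrDl; rewrite big_split /= -!cE.
- apply: (cP (r ^+ (p ^ e) * x) (fun i => r * c x i)).
  by under eq_bigr do rewrite exprMn -mulrA; rewrite -mulr_sumr -cE.
- exact: cE.
apply: (cP _ (fun i => (i == j)%:R)); rewrite (bigD1 j) //= eqxx expr1n mul1r.
rewrite big1 ?addr0 // => l /negbTE ->.
by rewrite expr0n gtn_eqF ?expn_gt0 ?prime_gt0 // mul0r.
Qed.

(** A spanning family of least size is free: a relation with [c j] nonzero would eliminate the j-th
    element. *)
Lemma F_finite_basis : F_finite p k ->
  exists (N : nat) (b : 'I_N -> k),
    (forall x, exists c : 'I_N -> k, x = \sum_i c i ^+ p * b i) /\
    (forall c : 'I_N -> k, \sum_i c i ^+ p * b i = 0 -> forall i, c i = 0).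
Proof.
pose span N (b : 'I_N -> k) := forall x, exists c : 'I_N -> k, x = \sum_i c i ^+ p * b i.
move=> [s sspan].
have exN : exists N, `[< exists b : 'I_N -> k, span N b >].
  exists (size s); apply/asboolP; exists (fun i => s`_i); exact: sspan.
have [N /asboolP[b bspan] Nmin] := ex_minnP exN.
exists N, b; split=> // c c0 j; apply: contrapT => /eqP cj0.
case: N b bspan c c0 j cj0 Nmin => [b _ c _ []//|N b bspan c c0 j cj0 Nmin].
have : (N.+1 <= N)%N.
  apply: Nmin; apply/asboolP; exists (fun i => b (lift j i)) => x.
  have [x' xE] := bspan x.
  exists (fun i => x' (lift j i) - x' j / c j * c (lift j i)).
  have E : x - (x' j / c j) ^+ p * \sum_i c i ^+ p * b i =
      \sum_i (x' i - x' j / c j * c i) ^+ p * b i.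
    rewrite {1}xE mulr_sumr -sumrB; apply: eq_bigr => i _.
    have := frobB 1 (x' i) (x' j / c j * c i); rewrite expn1 => ->.
    by rewrite mulrBl [(_ * c i) ^+ p]exprMn mulrA.
  rewrite c0 mulr0 subr0 in E; rewrite E (bigD1_ord j) //=.
  by rewrite divfK // subrr expr0n gtn_eqF ?prime_gt0 // mul0r add0r.
by rewrite ltnn.
Qed.

Lemma F_finite_frob_dual : F_finite p k -> forall e,
  exists (T : finType) (c : T -> k -> k) (b : T -> k), frob_dual (p ^ e) c b.
Proof.
move=> /F_finite_basis[N [b [bspan bfree]]].
have [c cb _] := @basis_frob_dual 1 _ b
  (fun x => ltac:(rewrite expn1; exact: bspan x))
  (fun c => ltac:(rewrite expn1; exact: bfree c)).
elim=> [|e [T [c' [b' cb']]]].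
  exists unit, (fun _ x => x), (fun _ => 1); rewrite expn0; split=> // x.
  by rewrite big_const card_unit /= mulr1 addr0.
by have := frob_dual_comp pchark cb cb'; do 3!eexists; eassumption.
Qed.

Lemma natr_frob e m : (m%:R : k) ^+ (p ^ e) = m%:R.
Proof.
elim: e => [|e IHe]; first by rewrite expn0.
by rewrite expnSr exprM IHe -[LHS](pFrobenius_autE pchark) pFrobenius_aut_nat.
Qed.

(** The characteristic is an argument so that ring morphism structures can be attached to this map,
    and likewise to [Fp_emb]. *)
Definition frobq (_ : p \in [pchar k]) (e : nat) (x : k) : k := x ^+ (p ^ e).

Definition Fp_emb (_ : p \in [pchar k]) (c : 'F_p) : k := (c : nat)%:R.

Lemma Fp_emb_nat m : Fp_emb pchark m%:R = m%:R.
Proof.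
rewrite /Fp_emb val_Fp_nat // [in RHS](divn_eq m p) natrD natrM.
by rewrite (pcharf0 pchark) mulr0 add0r.
Qed.

End FieldDual.

Section Morphisms.
Variables (k : fieldType) (p e : nat) (pchark : p \in [pchar k]).

Fact frobq_zmod : zmod_morphism (@frobq k p pchark e).
Proof. by move=> x y; apply: frobB. Qed.

Fact frobq_monoid : monoid_morphism (@frobq k p pchark e).
Proof. by split=> [|x y]; rewrite /frobq ?expr1n ?exprMn. Qed.

HB.instance Definition _ := GRing.isZmodMorphism.Build k k (frobq pchark e) frobq_zmod.
HB.instance Definition _ := GRing.isMonoidMorphism.Build k k (frobq pchark e) frobq_monoid.

Fact Fp_emb_zmod : zmod_morphism (@Fp_emb k p pchark).
Proof.
have nE (x : 'F_p) : x = (x : nat)%:R by rewrite natr_Zp.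
have D x y : Fp_emb pchark (x + y) = Fp_emb pchark x + Fp_emb pchark y.
  by rewrite {1}(nE x) {1}(nE y) -natrD Fp_emb_nat natrD.
by move=> x y; apply: (addIr (Fp_emb pchark y)); rewrite -D !subrK.
Qed.

Fact Fp_emb_monoid : monoid_morphism (@Fp_emb k p pchark).
Proof.
have nE (x : 'F_p) : x = (x : nat)%:R by rewrite natr_Zp.
split=> [|x y]; first exact: (Fp_emb_nat pchark 1).
by rewrite {1}(nE x) {1}(nE y) -natrM Fp_emb_nat natrM.
Qed.

HB.instance Definition _ := GRing.isZmodMorphism.Build 'F_p k (Fp_emb pchark) Fp_emb_zmod.
HB.instance Definition _ := GRing.isMonoidMorphism.Build 'F_p k (Fp_emb pchark) Fp_emb_monoid.

End Morphisms.

(** * The field F_p(alpha) over its p^e-th powers *)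

Section GenericPoint.
Variables (k : fieldType) (p l : nat) (alpha : 'I_l -> k).
Hypothesis pchark : p \in [pchar k].
Implicit Types g h : {mpoly 'F_p[l]}.

Lemma evalFpE g : evalFp alpha g = mmap (Fp_emb pchark) alpha g.
Proof. by []. Qed.

Lemma evalFpX g m : evalFp alpha (g ^+ m) = evalFp alpha g ^+ m.
Proof. by rewrite !evalFpE rmorphXn. Qed.

Lemma evalFpM g h : evalFp alpha (g * h) = evalFp alpha g * evalFp alpha h.
Proof. by rewrite !evalFpE rmorphM. Qed.

Lemma evalFp_prod (T : Type) (r : seq T) (F : T -> {mpoly 'F_p[l]}) :
  evalFp alpha (\prod_(i <- r) F i) = \prod_(i <- r) evalFp alpha (F i).
Proof. by rewrite evalFpE rmorph_prod. Qed.

Lemma evalFp_sum (T : Type) (r : seq T) (F : T -> {mpoly 'F_p[l]}) :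
  evalFp alpha (\sum_(i <- r) F i) = \sum_(i <- r) evalFp alpha (F i).
Proof. by rewrite evalFpE rmorph_sum. Qed.

Lemma evalFpXm m : evalFp alpha ('X_[m] : {mpoly 'F_p[l]}) = mmap1 alpha m.
Proof. by rewrite evalFpE mmapX. Qed.

Hypothesis gen : field_generated alpha.
Hypothesis indep : alg_indep p alpha.

Lemma generated_subfield (S : set k) :
  is_subfield S -> (forall j, S (alpha j)) -> forall x, S x.
Proof.
move=> Sfield Salpha x; have : smallest (@is_subfield k) (range alpha) x by rewrite gen.
by apply; split=> // _ [j _ <-].
Qed.

Lemma frac_evalFp x : exists g h : {mpoly 'F_p[l]},
  h != 0 /\ x = evalFp alpha g / evalFp alpha h.
Proof.
have ev0 (h : {mpoly 'F_p[l]}) : h != 0 -> evalFp alpha h != 0.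
  by apply: contraNneq => /indep ->.
move: x; apply: generated_subfield => [|j]; last first.
  exists 'X_j, 1; rewrite oner_neq0 evalFpXm mmap1U; split=> //.
  by rewrite -{1}[1]mpolyX0 evalFpXm mmap11 divr1.
split=> [|x y [g [h [h0 ->]]] [g' [h' [h0' ->]]]|x y [g [h [h0 ->]]] [g' [h' [h0' ->]]]
          |x [g [h [h0 ->]]]].
- by exists 1, 1; rewrite oner_neq0 divff // ev0 ?oner_neq0.
- exists (g * h' - g' * h), (h * h'); rewrite mulf_neq0 //; split=> //.
  rewrite -mulNr addf_div ?ev0 // evalFpM !evalFpE rmorphB !rmorphM /=.
  by rewrite mulNr.
- exists (g * g'), (h * h'); rewrite mulf_neq0 //; split=> //.
  by rewrite mulf_div !evalFpM.
have [g0|g0] := eqVneq g 0.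
  by exists 0, 1; rewrite oner_neq0 g0 evalFpE rmorph0 !mul0r invr0.
by exists h, g; rewrite invf_div.
Qed.

(** With q = p^e, the ring k^q[alpha], the image of [phi], is closed under inverses since x^-1 =
    (x^-1)^q x^(q-1); hence it is k. Exponents of alpha are then reduced modulo q, the quotients
    going into the coefficients. *)
Lemma generic_span e x : exists c : {ffun 'I_l -> 'I_(p ^ e)} -> k,
  x = \sum_r c r ^+ (p ^ e) * mmap1 alpha (mbox r).
Proof.
pose phi := mmap (frobq pchark e) alpha.
have [f ->] : exists f, x = phi f.
  move: x; apply: generated_subfield => [|j]; last first.
    by exists 'X_j; rewrite /phi mmapX mmap1U.
  split=> [|_ _ [f ->] [g ->]|_ _ [f ->] [g ->]|x [f xE]].
  - by exists 1; rewrite /phi rmorph1.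
  - by exists (f - g); rewrite /phi rmorphB.
  - by exists (f * g); rewrite /phi rmorphM.
  have [->|x0] := eqVneq x 0; first by exists 0; rewrite /phi rmorph0 invr0.
  exists ((x^-1)%:MP * f ^+ (p ^ e).-1).
  rewrite /phi rmorphM rmorphXn /= mmapC -/phi -xE.
  change (x^-1 = x^-1 ^+ (p ^ e) * x ^+ (p ^ e).-1).
  have p_gt0 : (0 < p ^ e)%N by apply: exp_pe_gt0 pchark e.
  by rewrite exprVn -{1}(prednK p_gt0) exprS invfM divfK // expf_neq0.
exists (fun r => \sum_(v <- msupp f | mmodn pchark e v == r)
                    f@_v * mmap1 alpha (mdivn v (p ^ e))).
rewrite /phi /mmap (partition_big (mmodn pchark e) predT) //=.
apply: eq_bigr => r _; rewrite (frob_sum pchark) mulr_suml; apply: eq_bigr => v /eqP <-.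
rewrite exprMn -mulrA; congr (_ * _).
have /eqP {1}-> : v == (mbox (mmodn pchark e v) + mdivn v (p ^ e) *+ (p ^ e))%MM.
  by rewrite (mbox_eq pchark) !eqxx.
rewrite /mmap1 -prodrXl -big_split /=; apply: eq_bigr => i _.
by rewrite mnmDE mulmnE exprD exprM mulrC.
Qed.

(** After clearing denominators, algebraic independence lifts a relation to an identity between
    polynomials over F_p, where the remainders of exponents modulo p^e separate its terms. *)
Lemma generic_free e (c : {ffun 'I_l -> 'I_(p ^ e)} -> k) :
  \sum_r c r ^+ (p ^ e) * mmap1 alpha (mbox r) = 0 -> forall r, c r = 0.
Proof.
have p_prime := pcharf_prime pchark; have pcharFp := pchar_Fp p_prime.
have ev0 (h : {mpoly 'F_p[l]}) : h != 0 -> evalFp alpha h != 0.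
  by apply: contraNneq => /indep ->.
move=> c0; have [G GP] := choice (fun r => frac_evalFp (c r)).
have [H HP] := choice GP.
pose D := \prod_r H r; have D0 : D != 0.
  by rewrite prodf_seq_neq0; apply/allP => r _; case: (HP r).
pose P r := G r * \prod_(s | s != r) H s.
have cE r : c r = evalFp alpha (P r) / evalFp alpha D.
  have [h0 ->] := HP r; rewrite /D (bigD1 r) //= !evalFpM.
  rewrite invfM mulrACA divff ?mulr1 // ev0 //.
  by rewrite prodf_seq_neq0; apply/allP => s _; apply/implyP => _; case: (HP s).
have sum0 : \sum_r P r ^+ (p ^ e) * 'X_[mbox r] = 0.
  apply: indep; rewrite evalFp_sum.
  apply: (mulfI (expf_neq0 (p ^ e) (invr_neq0 (ev0 _ D0)))); rewrite mulr0 -[RHS]c0.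
  rewrite mulr_sumr; apply: eq_bigr => r _.
  by rewrite evalFpM evalFpX evalFpXm cE exprMn mulrCA mulrA.
(* Frobenius is the identity on F_p, so 1 is a basis with the identity as coordinate. *)
have FpD : @frob_dual 'F_p (p ^ e) unit (fun _ x => x) (fun _ => 1).
  split=> [//|_ r x|x]; last first.
    by rewrite big_const card_unit /= mulr1 addr0 -[x]natr_Zp natr_frob.
  by rewrite -{1}[r]natr_Zp natr_frob // natr_Zp.
have [LD LM _] := lift_frob_dual l pcharFp FpD.
move=> s; rewrite cE.
suff -> : P s = 0 by rewrite evalFpE rmorph0 mul0r.
rewrite -[RHS](_ : lift_coord pcharFp (fun _ x => x) (tt, s) 0 = 0); last first.
  by apply/mpolyP => w; rewrite (mcoeff_lift_coord _ FpD) !mcoeff0.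
rewrite -sum0 (big_morph _ (LD (tt, s)) (_ : _ = 0)); last first.
  by apply/mpolyP => w; rewrite (mcoeff_lift_coord _ FpD) !mcoeff0.
have LX r : lift_coord pcharFp (fun _ x => x) (tt, s) 'X_[mbox r] = (r == s)%:R.
  have /esym := mbox_eq pcharFp (mbox r) 0%MM r.
  have -> : (mbox r + 0 *+ (p ^ e) = mbox r)%MM.
    by apply/mnmP => j; rewrite mnmDE mulmnE mnm0E addn0.
  rewrite eqxx => /andP[/eqP m0 /eqP d0]; apply/mpolyP => w.
  rewrite (mcoeff_lift_coord _ FpD) mcoeffX (mbox_eq pcharFp) m0 d0.
  by case: eqP; rewrite ?mcoeff0 // mcoeff1 eq_sym.
rewrite (bigD1 s) //= big1 ?addr0 => [|r rs]; rewrite LM LX ?eqxx ?mulr1 //.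
by rewrite (negbTE rs) mulr0.
Qed.

Lemma generic_frob_dual e : exists c : {ffun 'I_l -> 'I_(p ^ e)} -> k -> k,
  frob_dual (p ^ e) c (fun r => mmap1 alpha (mbox r)) /\
  forall r s, c r (mmap1 alpha (mbox s)) = (r == s)%:R.
Proof.
have [c cb cE] := basis_frob_dual pchark (generic_span e) (@generic_free e).
by exists c.
Qed.

End GenericPoint.

(** * Powers of f *)

Lemma exp_ideal_exp (A : comNzRingType) (I : set A) (x : A) m :
  I x -> exp_ideal I m (x ^+ m).
Proof.
move=> Ix; elim: m => [//|m IHm]; rewrite exprS.
by apply: sub_gen_ideal; exists x, (x ^+ m).
Qed.

(** By induction on the digits: f^m is the product of f^(m mod p) and the p-th power of f^(m div
    p). *)
Lemma exp_fexp (n d p : nat) (k : fieldType) (f : {mpoly k[n]}) m :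
  p \in [pchar k] -> mon_ideal k (fun v => (d <= mdeg v)%N) f ->
  mon_ideal k (fexp d p m) (f ^+ m).
Proof.
move=> pchark fd; have p_prime := pcharf_prime pchark; have p_gt1 := prime_gt1 p_prime.
have [N] := ubnP m; elim: N m => [//|N IHN] m; rewrite ltnS => mN.
have [->|m_gt0] := posnP m; first by move=> v _; apply: Fexp0.
have mp : (m %/ p < N)%N by rewrite (leq_trans _ mN) // ltn_Pdiv.
rewrite {2}(divn_eq m p) addnC exprD exprM => v /msuppM_le/allpairsP[[v0 v1] [/= v0s v1s ->]].
have := exp_ideal_exp (m %% p) fd; rewrite exp_mdeg_ideal => /(_ _ v0s) dv0.
have up : upset (@fexp n d p (m %/ p)) by move=> x y; apply: fexp_up.
have := @frob_ideal_exp _ p 1 _ _ (IHN _ mp); rewrite frob_mon_ideal // expn1.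
move=> /(_ _ v1s)[w fw /mnm_lepP le]; apply/fexpP => //; exists v0, w; split=> //.
by apply/mnm_lepP => i; rewrite !mnmDE leq_add2l.
Qed.

Lemma frob_root_exp_sub (n d p : nat) (k : fieldType) e m (T : finType) c b
    (f : {mpoly k[n]}) :
  p \in [pchar k] -> @frob_dual k (p ^ e) T c b ->
  mon_ideal k (fun v => (d <= mdeg v)%N) f ->
  frob_root p e [set f ^+ m] `<=` mon_ideal k (rexp d p m e).
Proof.
move=> pchark cb fd; have p_gt1 := prime_gt1 (pcharf_prime pchark).
rewrite -(frob_root_mon_ideal pchark cb); last by move=> x y; apply: fexp_up.
by apply: frob_root_mono => _ ->; apply: exp_fexp.
Qed.

Section Combination.
Variables (n d l p : nat) (a : l.-tuple 'X_{1..n}) (k : fieldType) (alpha : 'I_l -> k).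
Hypotheses (ha : lists_monomials d a) (pchark : p \in [pchar k]).

Let p_prime : prime p. Proof. exact: pcharf_prime pchark. Qed.

Local Notation f := (monomial_comb a alpha).
Local Notation Z := (sumX l p).

Lemma monomial_comb_exp m :
  f ^+ m = \sum_(u <- msupp (Z ^+ m))
    (Fp_emb pchark (Z ^+ m)@_u * mmap1 alpha u) *: 'X_[wt a u].
Proof.
pose h j : {mpoly k[n]} := alpha j *: 'X_[tnth a j].
pose phi := mmap (@mpolyC n k \o Fp_emb pchark) h.
have -> : f = phi Z.
  by rewrite /phi rmorph_sum /=; apply: eq_bigr => j _; rewrite mmapX mmap1U.
rewrite -[LHS](rmorphXn phi) /phi /mmap; apply: eq_bigr => u _ /=.
rewrite mul_mpolyC -scalerA; congr (_ *: _).
rewrite /mmap1 /h /wt; under eq_bigr do rewrite exprZn mpolyXn.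
rewrite scaler_prod; congr (_ *: _).
by rewrite (big_morph (fun v => 'X_[k, v]) (@mpolyXD n k) (mpolyX0 n k)).
Qed.

(** The coefficient of x^w in the m-th power of the generic form, as a polynomial in its
    coefficients z. *)
Definition coef_poly m w : {mpoly 'F_p[l]} :=
  \sum_(u <- msupp (Z ^+ m) | wt a u == w) (Z ^+ m)@_u *: 'X_[u].

Lemma mcoeff_monomial_comb m w : (f ^+ m)@_w = evalFp alpha (coef_poly m w).
Proof.
rewrite monomial_comb_exp (evalFpE _ pchark) !raddf_sum /= [RHS]big_mkcond.
apply: eq_bigr => u _; rewrite mcoeffZ mcoeffX.
case: eqP => [_|_]; rewrite ?mulr0 ?mulr1 // mmapZ mmapX //.
Qed.

(** Several [u] may have the same [wt], but they give distinct monomials in z, so nothing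
    cancels. *)
Lemma coef_poly_neq0 m u : (Z ^+ m)@_u != 0 -> coef_poly m (wt a u) != 0.
Proof.
move=> Zu; have us : u \in msupp (Z ^+ m) by rewrite mcoeff_msupp.
apply: contraNneq Zu => /(congr1 (mcoeff u)); rewrite mcoeff0 => /eqP.
rewrite /coef_poly big_mkcond raddf_sum (bigD1_seq u) ?msupp_uniq //=.
rewrite eqxx mcoeffZ mcoeffX eqxx mulr1 big1 ?addr0 // => v vu.
by case: ifP; rewrite ?mcoeff0 // mcoeffZ mcoeffX (negbTE vu) mulr0.
Qed.

Lemma monomial_comb_mon : mon_ideal k (fun v => (d <= mdeg v)%N) f.
Proof.
have Jid := mon_ideal_ideal k (@upset_mdeg n d).
apply: ideal_sum => // j _; rewrite -mul_mpolyC; case: (Jid) => _ _ JM; apply: JM.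
apply: mon_idealX; have [_ /(_ (tnth a j))] := ha.
by rewrite mem_tnth => /esym/eqP ->.
Qed.

Lemma mdeg_msupp_monomial_comb m v : v \in msupp (f ^+ m) -> mdeg v = (d * m)%N.
Proof.
rewrite monomial_comb_exp => /msupp_sum_le/flattenP[_ /mapP[u us ->]].
move/msuppZ_le; rewrite msuppX inE => /eqP ->; rewrite (mdeg_wt ha); congr (_ * _)%N.
by move: us; rewrite mem_filter mcoeff_msupp => /sumX_homog.
Qed.

(** The [u] that occur have degree m < p^e, so the alpha^u are distinct elements of the basis of k
    over its p^e-th powers. The coordinate at alpha^u isolates the term of [u], even when other
    terms share its monomial in x. *)
Lemma generic_frob_root e m : alg_indep p alpha -> field_generated alpha ->
  (m < p ^ e)%N -> frob_root p e [set f ^+ m] = mon_ideal k (rexp d p m e).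
Proof.
move=> indep gen me; have [c [cb cE]] := generic_frob_dual pchark gen indep e.
have p_gt1 := prime_gt1 p_prime.
have Rid := frob_root_ideal p e [set f ^+ m].
apply/seteqP; split; first exact: (frob_root_exp_sub pchark cb monomial_comb_mon).
apply/mon_ideal_sub => // v [w fw ltw].
have [u [Zu _ /mnm_lepP uw]] := fexp_wt p_prime ha fw.
have q_gt0 : (0 < p ^ e)%N by rewrite expn_gt0 ltnW.
have le : (mdivn (wt a u) (p ^ e) <= v)%MM.
  apply/mnm_lepP => i; rewrite mnmE -ltnS ltn_divLR // mulnC.
  exact: leq_ltn_trans (uw i) (ltw i).
apply: (idealX_up Rid le).
have mboxK (u' : 'X_{1..l}) : u' \in msupp (Z ^+ m) -> mbox (mmodn pchark e u') = u'.
  rewrite mcoeff_msupp => /sumX_homog du'; apply/mnmP => i; rewrite mnmE ffunE /=.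
  by rewrite modn_small // (leq_ltn_trans (leq_mnm_mdeg u' i)) // du'.
have us : u \in msupp (Z ^+ m) by rewrite mcoeff_msupp.
have := @frob_dual_root _ _ _ _ _ _ (lift_frob_dual n pchark cb)
  (mmodn pchark e u, mmodn pchark e (wt a u)) [set f ^+ m] _ erefl.
have -> : lift_coord pchark c (mmodn pchark e u, mmodn pchark e (wt a u)) (f ^+ m) =
    Fp_emb pchark (Z ^+ m)@_u *: 'X_[mdivn (wt a u) (p ^ e)].
  have [cD cM _] := cb.
  have emb_c i C y : c i (Fp_emb pchark C * y) = Fp_emb pchark C * c i y.
    by rewrite -cM /Fp_emb natr_frob.
  have cmm u' : u' \in msupp (Z ^+ m) -> c (mmodn pchark e u) (mmap1 alpha u') =
      (mmodn pchark e u == mmodn pchark e u')%:R.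
    by move=> u's; rewrite -cE mboxK.
  apply/mpolyP => x; rewrite (mcoeff_lift_coord _ cb) monomial_comb_exp raddf_sum /=.
  rewrite (big_morph _ (cD _) (coord0 cb _)) (bigD1_seq u) ?msupp_uniq //=.
  rewrite big1_seq ?addr0 => [|u' /andP[u'u u's]].
    rewrite !mcoeffZ !mcoeffX (mbox_eq pchark) eqxx /= -mulrA emb_c.
    case: eqP => [_|_]; rewrite ?mulr0 ?(coord0 cb) ?mulr0 // !mulr1.
    by rewrite cmm ?eqxx ?mulr1.
  rewrite mcoeffZ mcoeffX -mulrA emb_c.
  case: eqP => _; rewrite ?mulr0 ?(coord0 cb) ?mulr0 // mulr1.
  rewrite cmm //; case: eqP => [E|]; last by rewrite mulr0.
  by rewrite -(mboxK u us) E (mboxK u' u's) eqxx in u'u.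
move=> Rx; case: Rid => _ _ /(_ (Fp_emb pchark (Z ^+ m)@_u)^-1%:MP _ Rx).
by rewrite mul_mpolyC scalerA mulVf ?scale1r // fmorph_eq0.
Qed.

End Combination.

(** * Test ideals of principal ideals *)

Section PrincipalRoots.
Variables (A : comNzRingType) (p : nat) (f : A).
Hypothesis pcharA : p \in [pchar A].
Hypothesis dualA : forall e, exists (T : finType) (c : T -> A -> A) (b : T -> A),
  frob_dual (p ^ e) c b.

Lemma frob_root_pow_le e m m' : (m' <= m)%N ->
  frob_root p e [set f ^+ m] `<=` frob_root p e [set f ^+ m'].
Proof.
move=> mm'; rewrite -[X in _ `<=` X]frob_root_gen; apply: frob_root_mono => _ ->.
by rewrite gen_ideal1; exists (f ^+ (m - m')); rewrite // -exprD subnK.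
Qed.

Lemma frob_root_powS e m : frob_root p e.+1 [set f ^+ (p * m)] = frob_root p e [set f ^+ m].
Proof.
have [T [c [b cb]]] := dualA e; have [T' [c' [b' cb']]] := dualA 1.
rewrite -addn1 -(frob_root_comp pcharA _ cb cb') mulnC exprM.
by have := frob_root_exp pcharA cb' (f ^+ m); rewrite expn1 => ->; rewrite frob_root_gen.
Qed.

Lemma frob_root_pow_step e m m' : (m' <= p * m)%N ->
  frob_root p e [set f ^+ m] `<=` frob_root p e.+1 [set f ^+ m'].
Proof. by rewrite -frob_root_powS; apply: frob_root_pow_le. Qed.

Lemma frob_root_pow_shift e s m :
  frob_root p e [set f ^+ (s * p ^ e + m)] =
  [set f ^+ s * y | y in frob_root p e [set f ^+ m]].
Proof.
have [T [c [b cb]]] := dualA e.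
by rewrite -(frob_root_scale cb) image_set1 -exprM -exprD.
Qed.

(** Taking e roots first disposes of [m] and brings out f^s; this is the recursion that prepends a
    leading digit. *)
Lemma frob_root_pow_lead e s m :
  frob_root p e.+1 [set f ^+ (s * p ^ e + m)] =
  frob_root p 1 [set f ^+ s * y | y in frob_root p e [set f ^+ m]].
Proof.
have [T [c [b cb]]] := dualA e; have [T' [c' [b' cb']]] := dualA 1.
by rewrite -frob_root_pow_shift (frob_root_comp pcharA _ cb' cb).
Qed.

Section Real.
Variable R : realType.
Implicit Types (t lambda : R).
Local Notation M := (@ceil_scaled p R).

Let p_gt1 : (1 < p)%N. Proof. exact: prime_gt1 (pcharf_prime pcharA). Qed.

Lemma frob_root_ceil_mono t e e' : 0 <= t -> (e <= e')%N ->
  frob_root p e [set f ^+ M t e] `<=` frob_root p e' [set f ^+ M t e'].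
Proof.
move=> t0 /subnK <-; elim: (e' - e)%N => [//|j IHj] x /IHj.
by apply: frob_root_pow_step; apply: ceil_scaledS.
Qed.

Lemma test_ideal_principal t : 0 <= t ->
  test_ideal p (gen_ideal [set f]) t =
  [set x | exists e, frob_root p e [set f ^+ M t e] x].
Proof.
move=> t0; have E e : frob_root p e (exp_ideal (gen_ideal [set f]) (M t e)) =
    frob_root p e [set f ^+ M t e] by rewrite exp_ideal_gen1 frob_root_gen.
apply/seteqP; split=> x [e xe].
  by exists e; rewrite -E; apply: xe.
by exists e => e' ee'; rewrite E; apply: frob_root_ceil_mono xe.
Qed.

(** Every lambda - eps is at most (ceil(lambda p^e) - 1) / p^e for some e, so the test ideal there
    contains the root at this fraction. *)
Lemma frob_root_jump lambda : 0 < lambda ->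
  (forall e, ~ (frob_root p e [set f ^+ (M lambda e).-1] `<=`
                test_ideal p (gen_ideal [set f]) lambda)) ->
  F_jumping_exponent p (gen_ideal [set f]) lambda.
Proof.
move=> l0 jump; split=> // eps /andP[e0 el].
have t0 : 0 <= lambda - eps by rewrite subr_ge0.
have tl : lambda - eps < lambda by rewrite gtrBl.
split=> [|sub].
  rewrite !test_ideal_principal ?(ltW l0) // => x [e xe]; exists e; apply: frob_root_pow_le xe.
  by apply: ceil_scaled_mono => //; apply: ltW.
have [e /(_ e (leqnn e)) lt] := ceil_scaled_gap p_gt1 t0 tl.
apply: (jump e); apply: subset_trans sub; rewrite test_ideal_principal // => x xe.
by exists e; apply: frob_root_pow_le xe; rewrite -ltnS prednK // (leq_trans _ lt).
Qed.

End Real.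
End PrincipalRoots.

(** * Decreasing chains and their uniform stabilization *)

Lemma vspace_of_set (K : fieldType) (vT : vectType K) (S : set vT) :
  S 0 -> (forall x y, S x -> S y -> S (x + y)) -> (forall c x, S x -> S (c *: x)) ->
  exists U : {vspace vT}, forall x, S x <-> x \in U.
Proof.
move=> S0 SD SZ.
(* A subspace of largest dimension inside [S] cannot be enlarged by an element of [S], hence is all
   of it. *)
pose Q m := `[< exists U : {vspace vT}, (forall x, x \in U -> S x) /\ \dim U = m >].
have exQ : exists m, Q m.
  by exists 0%N; apply/asboolP; exists 0%VS; split=> [x|]; rewrite ?memv0 ?dimv0 // => /eqP ->.
have boundQ m : Q m -> (m <= \dim {:vT})%N.
  by move=> /asboolP[U [_ <-]]; apply: dimvS (subvf U).
case: (ex_maxnP exQ boundQ) => m /asboolP[U [US dimU]] maxU.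
exists U => x; split=> [Sx|]; last exact: US.
have : (\dim (U + <[x]>) <= \dim U)%N.
  rewrite dimU; apply: maxU; apply/asboolP; exists (U + <[x]>)%VS; split=> // y.
  by move=> /memv_addP[u Uu [_ /vlineP[c ->] ->]]; apply: SD; [apply: US|apply: SZ].
move=> dimle; have /eqP -> : U == (U + <[x]>)%VS by rewrite eqEdim addvSl.
by rewrite (subvP (addvSr _ _)) // memv_line.
Qed.

(** Dimensions drop strictly until the first equality, which thus occurs at an index at most the
    total dimension; by the last hypothesis it persists. *)
Lemma chain_stab (K : fieldType) (vT : vectType K) (Y : nat -> set vT) :
  (forall e, Y e 0) -> (forall e x y, Y e x -> Y e y -> Y e (x + y)) ->
  (forall e c x, Y e x -> Y e (c *: x)) ->
  (forall e, Y e.+1 `<=` Y e) ->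
  (forall e, Y e `<=` Y e.+1 -> Y e.+1 `<=` Y e.+2) ->
  forall e, Y (\dim {:vT}) `<=` Y e.
Proof.
move=> Y0 YD YZ Ydecr Ystep.
have [U UP] := choice (fun e => vspace_of_set (Y0 e) (YD e) (YZ e)).
have decr e j : Y (e + j)%N `<=` Y e.
  elim: j => [|j IHj]; first by rewrite addn0.
  by rewrite addnS; apply: subset_trans IHj.
have Udecr e : (U e.+1 <= U e)%VS by apply/subvP => x /UP/Ydecr/UP.
have [e0 e0N st] : exists2 e0, (e0 <= \dim {:vT})%N & Y e0 `<=` Y e0.+1.
  apply: contrapT => noN.
  have dimE e : (e <= (\dim {:vT}).+1)%N -> (\dim (U e) + e <= \dim {:vT})%N.
    elim: e => [_|e IHe eN]; first by rewrite addn0 dimvS ?subvf.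
    have lt : (\dim (U e.+1) < \dim (U e))%N.
      rewrite ltnNge; apply/negP => ge; apply: noN; exists e => // x /UP.
      have /eqP <- : U e.+1 == U e by rewrite eqEdim Udecr.
      by move/UP.
    by apply: leq_trans (IHe (ltnW eN)); rewrite addnS -addSn leq_add2r.
  by have := dimE _ (leqnn _); rewrite addnS ltnNge leq_addl.
have stab e : Y e0 `<=` Y (e0 + e)%N.
  suff : Y (e0 + e)%N `<=` Y (e0 + e).+1 /\ Y e0 `<=` Y (e0 + e)%N by case.
  elim: e => [|e [IH1 IH2]]; first by rewrite addn0; split.
  by rewrite addnS; split; [apply: Ystep|apply: subset_trans IH2 IH1].
move=> e; rewrite -(subnKC e0N) => x /decr/(stab e).
by rewrite addnC; apply: decr.
Qed.

Section Stability.
Variables (R : realType) (n d p : nat) (T : finType) (F : T -> R) (next : T -> T).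
Variables (k : fieldType) (f : {mpoly k[n]}).
Local Notation M := (@ceil_scaled p R).
Hypothesis pchark : p \in [pchar k].
Hypothesis dual : forall e, exists (T : finType) (c : T -> k -> k) (b : T -> k),
  frob_dual (p ^ e) c b.
Hypothesis F01 : forall i, 0 < F i <= 1.
Hypothesis F_next : forall i, F i * p%:R = (M (F i) 1).-1%:R + F (next i).
Hypothesis f_deg : forall m v, v \in msupp (f ^+ m) -> (mdeg v <= d * m)%N.

Let p_gt1 : (1 < p)%N. Proof. exact: prime_gt1 (pcharf_prime pchark). Qed.
Let pcharA : p \in [pchar {mpoly k[n]}]. Proof. exact: pchar_mpoly. Qed.

Lemma mpoly_dual e : exists (T' : finType) (c : T' -> {mpoly k[n]} -> {mpoly k[n]}) b,
  frob_dual (p ^ e) c b.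
Proof.
have [T' [c [b cb]]] := dual e; do 3!eexists; exact: (lift_frob_dual n pchark cb).
Qed.

Local Notation I e i := (frob_root p e [set f ^+ (M (F i) e).-1]).

Lemma root_decr e i : I e.+1 i `<=` I e i.
Proof.
have /andP[f0 f1] := F01 i.
(* Writing m_e for the largest integer below F_i p^e, one has p m_e <= m_(e+1). *)
rewrite -[X in _ `<=` X](frob_root_powS f pcharA mpoly_dual); apply: frob_root_pow_le.
rewrite -ltnS prednK ?ceil_scaled_gt0 // ltn_ceil_scaled ?(ltW f0) //.
rewrite natrM expnS natrM mulrCA ltr_pM2l ?ltr0n ?(ltnW p_gt1) //.
exact: ceil_scaled_pred_lt.
Qed.

Lemma rootS e i :
  I e.+1 i = frob_root p 1 [set f ^+ (M (F i) 1).-1 * y | y in I e (next i)].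
Proof.
have /andP[f0 f1] := F01 i; have /andP[g0 g1] := F01 (next i).
rewrite -(frob_root_pow_lead f pcharA mpoly_dual) -addn1.
rewrite (@ceil_scaled_shift R p (F i) (F (next i)) (M (F i) 1).-1 1 e) ?(ltW f0) ?(ltW g0) //.
congr (frob_root p _ (set1 (f ^+ _))).
by rewrite -[in LHS](prednK (ceil_scaled_gt0 p_gt1 e g0)) addnS.
Qed.

(** The power of f has degree at most d p^e, so its coordinates, which generate the root, have
    degree at most d. *)
Lemma root_gen_deg e i (J : set {mpoly k[n]}) : is_ideal J ->
  (forall h, (forall v, v \in msupp h -> (mdeg v <= d)%N) -> I e i h -> J h) ->
  I e i `<=` J.
Proof.
move=> Jid IJ; have [T' [c [b cb]]] := dual e.
have Lcb := lift_frob_dual n pchark cb.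
have q_gt0 : (0 < p ^ e)%N by rewrite expn_gt0 ltnW.
rewrite (frob_rootE_dual Lcb); apply/gen_ideal_sub => // _ [_ -> [[j r] ->]].
apply: IJ; last exact: (frob_dual_root Lcb).
move=> v; rewrite mcoeff_msupp (mcoeff_lift_coord _ cb).
have [/eqP|fv] := eqVneq (f ^+ (M (F i) e).-1)@_(mbox r + v *+ p ^ e) 0.
  by move/eqP => ->; rewrite (coord0 cb) eqxx.
move=> _; rewrite -mcoeff_msupp in fv; have := f_deg fv; rewrite mdegD mdegMn => le.
rewrite -(leq_pmul2r q_gt0); apply: leq_trans (leq_trans (leq_addl _ _) le) _.
by rewrite leq_mul2l (leq_trans (leq_pred _)) ?orbT // ceil_scaled_le1.
Qed.

(* One more base p digit of all the F i at once only depends on the previous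
   ideals, so that the finite family of decreasing chains [I e i], which is
   generated in degrees <= d, stops for good as soon as it stops once. *)
Lemma root_stab e i : I #|{: T * 'X_{1..n < d.+1}}| i `<=` I e i.
Proof.
(* A vector of length [N] encodes one polynomial of degree at most d for each index in [T]. Treating
   all indices together lets the recursion through [next] stay inside one chain. *)
set N := #|_|; pose P i (g : 'rV[k]_N) : {mpoly k[n]} :=
  \sum_(v : 'X_{1..n < d.+1}) g 0 (enum_rank (i, v)) *: 'X_[v].
have P0 j : P j 0 = 0 by rewrite /P big1 // => v _; rewrite mxE scale0r.
have PD j x y : P j (x + y) = P j x + P j y.
  by rewrite /P -big_split; apply: eq_bigr => v _; rewrite mxE scalerDl.
have PZ j c x : P j (c *: x) = c%:MP * P j x.
  by rewrite /P mulr_sumr; apply: eq_bigr => v _; rewrite mxE mul_mpolyC scalerA.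
pose Y e : set 'rV[k]_N := [set g | forall j, I e j (P j g)].
(* A single polynomial is extended by zero at the other indices. *)
have Yreal h e' j : (forall v, v \in msupp h -> (mdeg v <= d)%N) -> I e' j h ->
    exists2 g, Y e' g & P j g = h.
  move=> hd hI; pose g : 'rV[k]_N := \row_m
    (let: (j', v) := enum_val m in if j' == j then h@_(bmnm v) else 0).
  have gE j' v : g 0 (enum_rank (j', v)) = if j' == j then h@_(bmnm v) else 0.
    by rewrite mxE enum_rankK.
  have PE : P j g = h.
    rewrite [RHS](@mpolywE _ _ d.+1).
      by apply: eq_bigr => v _; rewrite gE eqxx.
    by rewrite msizeE; apply/bigmax_leqP_seq => v vh _; rewrite ltnS hd.
  exists g => // j'; have [->|/negbTE j'j] := eqVneq j' j; first by rewrite PE.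
  rewrite (_ : P j' g = 0); first by case: (frob_root_ideal p e' [set f ^+ (M (F j') e').-1]).
  by rewrite /P big1 // => v _; rewrite gE j'j scale0r.
have Yle e1 e2 : Y e1 `<=` Y e2 -> forall j, I e1 j `<=` I e2 j.
  move=> Y12 j; apply: root_gen_deg => [|h hd /(Yreal _ _ _ hd)[g /Y12 Yg <-]].
    exact: frob_root_ideal.
  exact: Yg.
have N_dim : \dim {:'rV[k]_N} = N by rewrite dimvf; exact: mul1n.
suff : Y N `<=` Y e by move/Yle; apply.
rewrite -[X in Y X]N_dim; apply: chain_stab => [e'|e' x y Yx Yy|e' c x Yx|e'|e' Yst] j.
- by rewrite P0; case: (frob_root_ideal p e' [set f ^+ (M (F j) e').-1]).
- rewrite PD; case: (frob_root_ideal p e' [set f ^+ (M (F j) e').-1]) => _ ID _.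
  by apply: ID.
- rewrite PZ; case: (frob_root_ideal p e' [set f ^+ (M (F j) e').-1]) => _ _ IM.
  by apply: IM.
- by move=> Yj j'; apply: root_decr.
- move=> Yj j'; have := Yj j'; rewrite (rootS e'.+1) rootS.
  apply: frob_root_mono => _ [y Iy <-]; exists y => //.
  exact: Yle Iy.
Qed.

End Stability.

(** Criticality gives [v] outside (m^d)^[mu] and a monomial x^(wt u) of the generic power with
    floor(wt u / p^e) <= v; [s] is its coefficient. If [s] does not vanish at alpha, the inclusion
    puts x^(wt u) into the p^e-th Frobenius power of (m^d)^[mu], and hence [v] into its
    exponents. *)
Lemma crit_coef_poly (R : realType) (n d l p : nat) (a : l.-tuple 'X_{1..n}) (mu : R) e :
  prime p -> lists_monomials d a -> crit_exp n d p mu ->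
  exists2 s : {mpoly 'F_p[l]}, s != 0 &
    forall (k : fieldType) (alpha : 'I_l -> k), p \in [pchar k] ->
      (exists (T : finType) (c : T -> k -> k) (b : T -> k), frob_dual (p ^ e) c b) ->
      evalFp alpha s != 0 ->
      ~ (frob_root p e [set monomial_comb a alpha ^+ (ceil_scaled p mu e).-1] `<=`
         mon_ideal k (frob_pow_exp d p mu)).
Proof.
move=> p_prime ha crit; have [v [w fw ltw] Nv] := crit e.
have [u [Zu _ /mnm_lepP uw]] := fexp_wt p_prime ha fw.
exists (coef_poly p a (ceil_scaled p mu e).-1 (wt a u)); first exact: coef_poly_neq0.
move=> k alpha pchark [T [c [b cb]]]; rewrite -(mcoeff_monomial_comb _ _ pchark).
rewrite -mcoeff_msupp => us sub; apply: Nv.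
have Lcb := lift_frob_dual n pchark cb.
have up := @frob_pow_exp_up R n d p mu.
have := @sub_frob_root _ _ _ _ _ _ Lcb
  [set monomial_comb a alpha ^+ (ceil_scaled p mu e).-1] _ erefl.
move/(frob_ideal_mono sub); rewrite frob_mon_ideal // => /(_ _ us)[w' Gw' /mnm_lepP le].
apply: up Gw'; apply/mnm_lepP => i; rewrite -ltnS.
have q_gt0 : (0 < p ^ e)%N by rewrite expn_gt0 prime_gt0.
rewrite -(ltn_pmul2l q_gt0); apply: leq_ltn_trans (ltw i).
by apply: leq_trans (uw i); have := le i; rewrite mulmnE mulnC.
Qed.

(** * Equality for generic coefficients, and the exceptional polynomial *)

Theorem corollary6p1 (R : realType) (n d p l : nat) (a : l.-tuple 'X_{1..n})
    (hn : (1 <= n)%N) (hd : (1 <= d)%N) (hp : prime p) (hdp : (d < p)%N)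
    (ha : lists_monomials d a) :
  (forall (k : fieldType) (alpha : 'I_l -> k),
     p \in [pchar k] -> F_finite p k ->
     field_generated alpha -> alg_indep p alpha ->
     forall t : R, 0 < t < 1 ->
       test_ideal p (gen_ideal [set monomial_comb a alpha]) t =
       frob_pow p (exp_ideal (@maxid n k) d) t)
  /\
  (exists Sigma : seq {mpoly 'F_p[l]},
     [/\ Sigma <> [::],
         (forall s, s \in Sigma -> s != 0)
       & forall (k : fieldType) (alpha : 'I_l -> k),
           p \in [pchar k] -> F_finite p k ->
           ~ zero_locus Sigma alpha ->
           forall lambda : R,
             critical_exponent p (exp_ideal (@maxid n k) d) lambda ->
             F_jumping_exponent p
               (gen_ideal [set monomial_comb a alpha]) lambda]).
Proof.
have p_gt1 := prime_gt1 hp.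
split=> [k alpha pchark kfin gen indep t t01|].
  have dual := F_finite_frob_dual pchark kfin; have /andP[/ltW t0 _] := t01.
  rewrite (frob_powE n d hp pchark dual) //.
  rewrite (test_ideal_principal _ (pchar_mpoly n pchark) (mpoly_dual n pchark dual)) //.
  (* From e0 on, ceil(t p^e) < p^e and the generic computation applies; both chains increase with e,
     so e may be enlarged. *)
  have [e0 lt_e0] := ceil_scaled_lt1 p_gt1 t01.
  apply/seteqP; split=> x.
    move=> [e /(frob_root_ceil_mono (pchar_mpoly n pchark) (mpoly_dual n pchark dual) t0
                 (leq_maxl e e0))].
    rewrite (generic_frob_root ha pchark indep gen); last by apply: lt_e0; apply: leq_maxr.
    by move=> xe v /xe ?; exists (maxn e e0).
  move=> xt; have [e e' v le|e xe] := @seq_uniform_bound _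
      (fun e => @rexp n d p (ceil_scaled p t e) e) (msupp x) _ xt.
    exact: rexp_ceil_mono.
  exists (maxn e e0); rewrite (generic_frob_root ha pchark indep gen); last first.
    by apply: lt_e0; apply: leq_maxr.
  by move=> v /xe; apply: rexp_ceil_mono => //; apply: leq_maxl.
have rexp_bound := @rexp_deg n d l p a hp ha.
have [T [F [next [F01 Fcrit Fall Fnext]]]] := crit_exp_finite R hp rexp_bound.
(* The index from which all chains of [root_stab] are stationary, fixed before any field is
   chosen. *)
set N := #|{: T * 'X_{1..n < d.+1}}|.
have /choice[s sP] i : exists s : {mpoly 'F_p[l]}, s != 0 /\ (F i < 1 ->
    forall (k : fieldType) (alpha : 'I_l -> k), p \in [pchar k] ->
      (exists (T : finType) (c : T -> k -> k) (b : T -> k), frob_dual (p ^ N) c b) ->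
      evalFp alpha s != 0 ->
      ~ (frob_root p N [set monomial_comb a alpha ^+ (ceil_scaled p (F i) N).-1] `<=`
         mon_ideal k (frob_pow_exp d p (F i)))).
  have [->|crit] := Fcrit i; first by exists 1; rewrite oner_neq0 ltxx.
  have [s s0 sP] := crit_coef_poly N hp ha crit.
  by exists s; split=> // _; apply: sP.
(* The power x_1^d provides a coefficient variable whose nonvanishing makes f nonzero. *)
have /tnthP[j0 _] : (U_(Ordinal hn) *+ d)%MM \in a.
  by case: ha => _ ->; rewrite mdegMn mdeg1 mul1n.
exists [:: 'X_j0 * \prod_i s i]; split=> // [g|k alpha pchark kfin NZ lambda crit].
  rewrite inE => /eqP ->; rewrite mulf_neq0 // -?msupp_eq0 ?msuppX //.
  by rewrite msupp_eq0 prodf_seq_neq0; apply/allP => i _; case: (sP i).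
have dual := F_finite_frob_dual pchark kfin.
have pcharA := pchar_mpoly n pchark; have dualA := mpoly_dual n pchark dual.
have : evalFp alpha ('X_j0 * \prod_i s i) != 0.
  by apply/eqP => E; apply: NZ => g; rewrite inE => /eqP ->.
rewrite (evalFpM alpha pchark) evalFpXm // mmap1U mulf_eq0 negb_or => /andP[aj0].
rewrite (evalFp_prod alpha pchark) => /prodf_neq0 sN0.
have fmon : mon_ideal k (fun v => (d <= mdeg v)%N) (monomial_comb a alpha).
  exact: monomial_comb_mon.
set f := monomial_comb a alpha in fmon *.
have f0 : f != 0.
  apply: contraNneq aj0 => /(congr1 (mcoeff (tnth a j0))); rewrite mcoeff0 => <-.
  rewrite /f /monomial_comb raddf_sum (bigD1 j0) //= mcoeffZ mcoeffX eqxx mulr1.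
  rewrite big1 ?addr0 // => j jj0; rewrite mcoeffZ mcoeffX; case: eqP; rewrite ?mulr0 //.
  by case: ha => /tuple_uniqP a_inj _ /a_inj jE; rewrite jE eqxx in jj0.
have l0 : 0 < lambda by case: crit.
have [s0 [mu [m01 lE mucrit]]] :=
  crit_exp_frac hp l0 (critical_exponent_exp hp pchark dual crit).
have /andP[m0 m1] := m01.
apply: (frob_root_jump pcharA dualA) => // e sub.
have shift e' : ceil_scaled p lambda e' = (s0 * p ^ e' + ceil_scaled p mu e')%N.
  rewrite -[e' in LHS]addn0; apply: ceil_scaled_shift; rewrite ?(ltW l0) ?(ltW m0) //.
  by rewrite expn0 mulr1.
(* Both sides for [lambda] are f^s0 times those for [mu], and f^s0 cancels in the domain k[x]. *)
have {}sub : frob_root p e [set f ^+ (ceil_scaled p mu e).-1] `<=`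
    test_ideal p (gen_ideal [set f]) mu.
  move=> y fy; rewrite test_ideal_principal ?(ltW m0) //.
  have := sub (f ^+ s0 * y); rewrite test_ideal_principal ?(ltW l0) // shift.
  rewrite -(prednK (ceil_scaled_gt0 p_gt1 e m0)) addnS /= frob_root_pow_shift //.
  have im : [set f ^+ s0 * y | y in frob_root p e [set f ^+ (ceil_scaled p mu e).-1]]
    (f ^+ s0 * y) by exists y.
  move=> /(_ im)[e']; rewrite shift frob_root_pow_shift // => -[z fz].
  by move=> /(mulfI (expf_neq0 s0 f0)) <-; exists e'.
(* For mu = 1 the inclusion puts f^(q-1) into the ideal generated by f^q, with q = p^e. Then f is a
   unit, which is impossible in m^d with d >= 1. *)
have [mu1|mu1] := eqVneq mu 1.
  have M1 e' : ceil_scaled p (1 : R) e' = (p ^ e')%N.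
    by have := ceil_scaled_nat R p 1 e'; rewrite mul1n mulr1n.
  have q_gt0 : (0 < p ^ e)%N by rewrite expn_gt0 prime_gt0.
  have {}sub : frob_root p e [set f ^+ (p ^ e).-1] `<=` gen_ideal [set f].
    move: sub; rewrite mu1 M1 => sub; apply: subset_trans sub _.
    rewrite test_ideal_principal ?ler01 // => y [e']; rewrite M1.
    by have [T' [c [b cb]]] := dualA e'; rewrite (frob_root_exp pcharA cb).
  have [T' [c [b cb]]] := dualA e.
  have fq := @sub_frob_root _ _ _ _ _ _ cb [set f ^+ (p ^ e).-1] _ erefl.
  have : gen_ideal [set f ^+ (p ^ e)] (f ^+ (p ^ e).-1).
    have : frob_ideal p e (gen_ideal [set f]) `<=` gen_ideal [set f ^+ (p ^ e)].
      apply/frob_ideal_sub => [|y]; first exact: gen_ideal_ideal.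
      rewrite !gen_ideal1 => -[r _ <-]; exists (r ^+ (p ^ e)) => //.
      by rewrite exprMn.
    by apply; apply: frob_ideal_mono sub _ fq.
  rewrite gen_ideal1 => -[r _]; rewrite -{1}(prednK q_gt0) exprS mulrA -[RHS]mul1r.
  move=> /(mulIf (expf_neq0 _ f0)) rf1.
  have [_ _ /(_ r _ fmon)] := mon_ideal_ideal k (@upset_mdeg n d).
  rewrite rf1 => /(_ 0%MM); rewrite -mpolyC1 msupp1 inE eqxx mdeg0 => /(_ isT).
  by rewrite leqNgt hd.
case: mucrit => [/eqP|mucrit]; first by rewrite (negbTE mu1).
have mu_lt1 : 0 < mu < 1 by rewrite m0 lt_neqAle mu1 m1.
have [i Fi] := Fall mu mu_lt1 mucrit.
have [_ /(_ _ _ alpha pchark (dual N) (sN0 i isT))] := sP i.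
rewrite Fi; case/andP: mu_lt1 => _ mu_lt1 /(_ mu_lt1); apply.
(* Stabilization passes from the given level e to [N], where [s i] was chosen; the test ideal lies
   in (m^d)^[mu], which contradicts that choice. *)
apply: subset_trans (_ : _ `<=` frob_root p e [set f ^+ (ceil_scaled p mu e).-1]) _.
  rewrite -Fi; apply: (root_stab (next := next) pchark dual F01 Fnext) => m v.
  by move/(mdeg_msupp_monomial_comb ha pchark) ->.
apply: subset_trans sub _; rewrite test_ideal_principal ?(ltW m0) // => x [e' xe'].
have [T' [c [b cb]]] := dual e'.
by move=> v /(frob_root_exp_sub pchark cb fmon xe') ?; exists e'.
Qed.
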